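(* Let $k_0,k_1>0$ be such that $\gamma=2(k_0+k_1)$ is an even (nonzero) integer, let $l_i=k_i-\tfrac12$ for $i\in\{0,1\}$, and let $x=\rho e^{i\phi}$, $y=re^{i\theta}$ with $\rho,r\ge0$ and $0\le\phi,\theta\le\pi/4$. Then $$D_k^W(x,y)=\Gamma\left(\frac{\gamma+1}{2}\right)\int_{-1}^1\int_{-1}^1 i_{(\gamma-1)/2}\big(\rho r\,c_{2\phi,2\theta}(u,v)\big)\,\mu^{l_1}(du)\,\mu^{l_0}(dv),$$ which is positive.
   Context: The generalized Bessel function of type $B_2$ is given, for $k=(k_0,k_1)$ and $x=\rho e^{i\phi}$, $y=re^{i\theta}$ with $\rho,r\geq0$, $0\le\phi,\theta\le\pi/4$, by $$D_k^W(x,y)=c_{2,k}\left(\frac{2}{r\rho}\right)^{\gamma}\sum_{j\ge0}I_{4j+\gamma}(\rho r)\,p_j^{l_1,l_0}(\cos4\phi)\,p_j^{l_1,l_0}(\cos4\theta),$$ $$c_{2,k}=2^{k_0+k_1}\frac{\Gamma(2(k_0+k_1)+1)\Gamma(k_1+1/2)\Gamma(k_0+1/2)}{\Gamma(k_0+k_1+1)},$$ (extended by continuity to $\rho r=0$, where its value is $1$). Here $I_\nu(z)=\sum_{m\ge0}\frac{1}{m!\,\Gamma(m+\nu+1)}(z/2)^{2m+\nu}$ is the modified Bessel function, and $p_j^{l_1,l_0}$ is the $j$-th orthonormal Jacobi polynomial, i.e. the polynomials $(p_j^{l_1,l_0})_{j\ge0}$, $\deg p_j^{l_1,l_0}=j$,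 are orthonormal in $L^2([-1,1],(1-s)^{l_1}(1+s)^{l_0}ds)$. For $\nu>-1/2$, $\mu^\nu$ is the symmetric Beta probability measure on $[-1,1]$ with density proportional to $(1-s^2)^{\nu-1/2}$. For $(u,v)\in[-1,1]^2$, $c_{2\phi,2\theta}(u,v)=\sqrt{\frac{1+u\cos2\theta\cos2\phi+v\sin2\theta\sin2\phi}{2}}$. The normalized modified Bessel function is $i_\nu(z)=\sum_{m\ge0}\frac{1}{\Gamma(m+\nu+1)\,m!}(z/2)^{2m}$.
   Formalization: The two Beta measures are exchanged: μ^{l_0}(du) μ^{l_1}(dv) replaces the printed μ^{l_1}(du) μ^{l_0}(dv), since with the given Jacobi weight the printed identity fails unless k_0=k_1 (e.g. k_0=1/4, k_1=3/4). *)

(* Defs.v *)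
From HB Require Import structures.
From mathcomp Require Import all_boot all_order all_algebra.
From mathcomp Require Import all_classical all_reals all_analysis.
From mathcomp Require Import measurable_realfun.

Set Implicit Arguments.
Unset Strict Implicit.
Unset Printing Implicit Defensive.

Import Order.TTheory GRing.Theory Num.Theory.
Import numFieldNormedType.Exports.

Local Open Scope classical_set_scope.
Local Open Scope ring_scope.

(* Euler's integral; meaningful for x > 0, which covers every use below. *)
Definition Gamma {R : realType} (x : R) : R :=
  Rintegral lebesgue_measure `]0, +oo[ (fun t => t `^ (x - 1) * expR (- t)).

(* The modified Bessel function I_nu(z), for z >= 0. *)
Definition bessel_I {R : realType} (nu z : R) : R :=
  limn (series (fun m : nat =>
    (z / 2) `^ ((2 * m)%:R + nu) / ((m`!)%:R * Gamma (m%:R + nu + 1)))).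

(* The normalized modified Bessel function i_nu(z). *)
Definition bessel_i {R : realType} (nu z : R) : R :=
  limn (series (fun m : nat =>
    (z / 2) ^+ (2 * m) / (Gamma (m%:R + nu + 1) * (m`!)%:R))).

(* Up to a sign for each p j, which cancels in the products used below,
   the orthonormal polynomials of L^2([-1,1], (1-s)^a (1+s)^b ds). The value
   given by powR to a negative power of 0 at the endpoints is irrelevant. *)
Definition orthonormal_jacobi {R : realType} (a b : R) (p : nat -> {poly R}) :
    Prop :=
  (forall j, size (p j) = j.+1) /\
  (forall i j,
    (\int[lebesgue_measure]_(s in `[(-1)%R, 1%R])
       ((p i).[s] * (p j).[s] * ((1 - s) `^ a * (1 + s) `^ b))%:E
     = ((i == j)%:R)%:E)%E).

Section symmetric_beta.
Context {R : realType}.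
Variable nu : R.

Definition sym_beta_weight (s : R) : \bar R :=
  (((fun t : R => (1 - t ^+ 2) `^ (nu - 2^-1)) \_ `[(-1)%R, 1%R]) s)%:E.

Lemma sym_beta_weight_ge0 s : (0 <= sym_beta_weight s)%E.
Proof.
rewrite /sym_beta_weight lee_fin patchE.
by case: ifPn => _ //; exact: powR_ge0.
Qed.

Lemma measurable_sym_beta_weight : measurable_fun [set: R] sym_beta_weight.
Proof.
apply/measurable_EFinP; apply/(measurable_restrictT _ _).1 => //.
apply: (measurableT_comp (measurable_powR _)).
apply: measurable_funTS; exact: measurable_funB.
Qed.

Definition sym_beta_mass (A : set (measurableTypeR R)) : \bar R :=
  (\int[lebesgue_measure]_(s in A) sym_beta_weight s)%E.

Let mass0 : sym_beta_mass set0 = 0%E.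
Proof. by rewrite /sym_beta_mass integral_set0. Qed.

Let mass_ge0 A : (0 <= sym_beta_mass A)%E.
Proof. by apply: integral_ge0 => s _; exact: sym_beta_weight_ge0. Qed.

Let mass_sigma_additive : semi_sigma_additive sym_beta_mass.
Proof.
apply: semi_sigma_additive_nng_induced.
- exact: measurable_sym_beta_weight.
- exact: sym_beta_weight_ge0.
Qed.

HB.instance Definition _ := isMeasure.Build _ _ _
  sym_beta_mass mass0 mass_ge0 mass_sigma_additive.

(* mu^nu. For nu > -1/2 the total mass is finite and nonzero, so the default
   argument of mnormalize plays no role. *)
Definition sym_beta : probability (measurableTypeR R) R :=
  mnormalize sym_beta_mass (dirac (0 : measurableTypeR R)).

End symmetric_beta.

(* c_{2 phi, 2 theta}(u, v) is c_angle (2 * phi) (2 * theta) u v. *)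
Definition c_angle {R : realType} (a b u v : R) : R :=
  Num.sqrt ((1 + u * cos b * cos a + v * sin b * sin a) / 2).

Definition c2 {R : realType} (k0 k1 : R) : R :=
  2 `^ (k0 + k1) *
  (Gamma (2 * (k0 + k1) + 1) * Gamma (k1 + 2^-1) * Gamma (k0 + 2^-1)) /
  Gamma (k0 + k1 + 1).

(* D_k^W(x, y) at x = rho e^{i phi}, y = r e^{i theta}; p stands for the
   orthonormal Jacobi polynomials of parameters (k1 - 1/2, k0 - 1/2). *)
Definition gbessel_B2 {R : realType} (k0 k1 : R) (p : nat -> {poly R})
    (rho phi r theta : R) : R :=
  let gamma := 2 * (k0 + k1) in
  if rho * r == 0 then 1
  else c2 k0 k1 * (2 / (r * rho)) `^ gamma *
    limn (series (fun j : nat =>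
      bessel_I ((4 * j)%:R + gamma) (rho * r) *
      (p j).[cos (4 * phi)] * (p j).[cos (4 * theta)])).

(* Main.v *)
From HB Require Import structures.
Require Import Defs.
From mathcomp Require Import all_boot all_order all_algebra.
From mathcomp Require Import all_classical all_reals all_analysis.
From mathcomp Require Import measurable_realfun.
From mathcomp Require Import ring lra zify.

Set Implicit Arguments.
Unset Strict Implicit.
Unset Printing Implicit Defensive.

Import Order.TTheory GRing.Theory Num.Theory.
Import numFieldNormedType.Exports.

Local Open Scope classical_set_scope.
Local Open Scope ring_scope.

(** Write N = k0 + k1, z = rho r, h = z / 2, x = cos (4 phi), y = cos (4 theta),
    c = cos (2 theta) cos (2 phi) and s = sin (2 theta) sin (2 phi). Both sides
    of the identity are power series in h ^ 2, and the proof compares the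
    coefficients of h ^ (2 m).

    On the integral side the coefficient is, up to Gamma factors, the double
    moment of ((1 + u c + v s) / 2) ^ m against mu^l0 and mu^l1. These measures
    are even, so only the moments of the even powers (u c + v s) ^ (2 i)
    survive. Since c ^ 2 and s ^ 2 are products of one factor in x and one in y,
    such a moment is a polynomial kernel K_i (x, y) ([even_kernel]), of degree i
    in each variable.

    The point is that the orthonormal Jacobi polynomials diagonalise K_i. The
    operator with kernel K_i is symmetric, and it is triangular with respect to
    the degree: by Beta integrals, it sends ((1 + X) / 2) ^ d to a multiple of
    a Bernstein-type sum of degree d ([kernel_op_half1pX]). A symmetric
    triangular operator is diagonal in the orthonormal basis, and the
    eigenvalues are read off the leading coefficients ([kernel_op_p]). Hence
    K_i (x, y) is a finite combination of the p_j (x) p_j (y), j <= i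
    ([kernel_expand]). Summing over i the eigenvalues, weighted by the binomial
    coefficients 'C(m, 2 i), is a terminating Gauss sum at 1
    ([binomial_poch_sum]); its value 1 / ((m - 2 j)! Gamma (m + 2 j + 2 N + 1)),
    up to factors independent of j, is exactly the coefficient of
    h ^ (2 m + 2 N) in I_(4 j + 2 N) (z). This is [addition_formula].

    It remains to exchange the sums over j and m on the side of the Jacobi
    polynomials, whose terms have no sign. For x = y all terms are nonnegative,
    and the product formula itself bounds the sums, because the double moments
    lie in [0, 1]. The general case follows by polarisation, as
    4 P Q = (P + Q) ^ 2 - (P - Q) ^ 2 ([rearrange_product]).

    Positivity is then clear: every double moment is nonnegative and the one
    for m = 0 is 1.

    The only facts of calculus needed are the functional equation of Gamma and
    the Beta integral. Both come from the identity
    Gamma a * Gamma b = Gamma (a + b) B (a, b), proved by Tonelli's theorem with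
    a shift and a scaling ([eGamma_mul]); for b = 1 it is the functional
    equation. *)

(** * Rising factorials and a Vandermonde sum *)

Section Pochhammer.
Context {R : realFieldType}.
Implicit Types (x nu : R) (m n L : nat).

Definition poch x n : R := \prod_(i < n) (x + i%:R).

Lemma poch0 x : poch x 0 = 1.
Proof. by rewrite /poch big_ord0. Qed.

Lemma pochSr x n : poch x n.+1 = poch x n * (x + n%:R).
Proof. by rewrite /poch big_ord_recr. Qed.

Lemma pochS x n : poch x n.+1 = x * poch (x + 1) n.
Proof.
rewrite /poch big_ord_recl addr0; congr (_ * _); apply: eq_bigr => i _.
by rewrite lift0 -nat1r addrA.
Qed.

Lemma pochD x m n : poch x (m + n) = poch x m * poch (x + m%:R) n.
Proof.
elim: n => [|n IH]; first by rewrite addn0 poch0 mulr1.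
by rewrite addnS !pochSr IH natrD addrA mulrA.
Qed.

Lemma poch_gt0 x n : 0 < x -> 0 < poch x n.
Proof. by move=> x0; apply: prodr_gt0 => i _; rewrite ltr_wpDr. Qed.

Lemma poch_ge1 x n : 1 <= x -> 1 <= poch x n.
Proof.
move=> x1; rewrite /poch; elim/big_ind: _ => //.
  by move=> a b; exact: mulr_ege1.
by move=> i _; apply: le_trans x1 _; rewrite lerDl.
Qed.

Lemma poch_neq0 x n : 0 < x -> poch x n != 0.
Proof. by move=> x0; rewrite gt_eqF// poch_gt0. Qed.

(** The duplication formula of the Gamma function, for rising factorials. *)
Lemma poch_double x n :
  poch (2 * x) (2 * n) = 4 ^+ n * (poch x n * poch (x + 2^-1) n).
Proof.
elim: n => [|n IH]; first by rewrite muln0 !poch0 expr0 !mul1r.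
rewrite mulnS !addSn add0n !pochSr IH exprS -natr1 natrM.
by field.
Qed.

Lemma ffactSD n k : (n.+1 ^_ k.+1 = n ^_ k.+1 + k.+1 * n ^_ k)%N.
Proof.
rewrite ffactSS ffactnSr.
have [kn|nk] := leqP k n; last by rewrite ffact_small// !muln0 mul0n.
by rewrite [(_ * (n - k))%N]mulnC -mulnDl addnS subnK.
Qed.


(** The hypergeometric series 2F1 (- L / 2, (1 - L) / 2; nu + 1; 1), cut at [D]:
    the falling factorials vanish once 2 t > L, so that every D > L gives the
    same value, and inductions may keep D free. *)
Definition vandermonde_sum D L nu : R :=
  \sum_(t < D) (L ^_ (2 * t))%:R / (4 ^+ t * t`!%:R * poch (nu + 1) t).

(** Pascal's rule for the falling factorials: the difference of two consecutive
    sums is, after a shift of t, a sum of the same shape with nu + 1. *)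
Lemma vandermonde_sumSS D L nu : 0 < nu ->
  vandermonde_sum D.+1 L.+2 nu =
  vandermonde_sum D.+1 L.+1 nu +
  L.+1%:R / (2 * (nu + 1)) * vandermonde_sum D L (nu + 1).
Proof.
move=> nu0; rewrite /vandermonde_sum !big_ord_recl -addrA; congr (_ + _).
rewrite mulr_sumr -big_split /=; apply: eq_bigr => i _.
rewrite /bump leq0n add1n mulnS !addSn add0n.
rewrite ffactSD natrD mulrDl; congr (_ + _).
rewrite ffactSS factS pochS !natrM exprS.
have p0 : poch (nu + 1 + 1) i != 0 by rewrite poch_neq0//; lra.
have f0 : (i`!)%:R != 0 :> R by rewrite pnatr_eq0 -lt0n fact_gt0.
have i0 : i%:R + 1 != 0 :> R by rewrite natr1 pnatr_eq0.
rewrite -!natr1 natrM.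
by field; rewrite p0 f0 i0 expf_neq0 /= ?andbT; lra.
Qed.

(** Gauss's evaluation at 1. The closed form satisfies the recurrence of
    [vandermonde_sumSS], whence a strong induction on L. *)
Lemma vandermonde_sumE D L nu : 0 < nu -> (L < D)%N ->
  vandermonde_sum D L nu =
  2 ^+ L * poch (nu + 2^-1) L / poch (2 * nu + 1) L.
Proof.
elim/ltn_ind: L D nu => -[|[|L]] IH [|D] nu nu0 // LD.
- rewrite /vandermonde_sum big_ord_recl big1 => [|i _].
    rewrite /= !poch0 addr0 muln0 ffactn0 expr0 fact0 !mulr1 divr1 //.
  by rewrite lift0 ffact_small ?mul0r// mulnS.
- rewrite /vandermonde_sum big_ord_recl big1 => [|i _].
    rewrite /= !pochSr !poch0 addr0 muln0 ffactn0 expr0 fact0 !mulr1 !mul1r.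
    by field; lra.
  by rewrite lift0 ffact_small ?mul0r// mulnS.
rewrite vandermonde_sumSS// (IH L.+1)// ?(ltnW LD)// (IH L)//; [|lra|exact: ltnW].
have -> : poch (2 * (nu + 1) + 1) L =
    poch (2 * nu + 1) L.+2 / ((2 * nu + 1) * (2 * nu + 2)).
  rewrite !pochS (_ : 2 * nu + 1 + 1 + 1 = 2 * (nu + 1) + 1); last by ring.
  by field; lra.
rewrite (_ : nu + 1 + 2^-1 = nu + 2^-1 + 1); last by ring.
have -> : poch (nu + 2^-1 + 1) L = poch (nu + 2^-1) L.+1 / (nu + 2^-1).
  by rewrite pochS; field; lra.
have := @poch_neq0 (2 * nu + 1) L.+1 ltac:(lra).
rewrite (pochSr (nu + 2^-1) L.+1) (pochSr (2 * nu + 1) L.+1) -!natr1 !exprS => p0.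
by field; rewrite p0 /=; have := ler0n R L; lra.
Qed.

Lemma poch_half n : poch 2^-1 n * (4 ^+ n * n`!%:R) = (2 * n)`!%:R :> R.
Proof.
elim: n => [|n IH]; first by rewrite muln0 poch0 expr0 fact0 !mulr1.
rewrite mulnS !addSn add0n !factS !natrM -IH pochSr exprS -!natr1 natrM.
by field.
Qed.

Lemma ffactD n m k : (n ^_ (m + k) = n ^_ m * (n - m) ^_ k)%N.
Proof.
elim: k => [|k IH]; first by rewrite addn0 ffactn0 muln1.
by rewrite addnS !ffactnSr IH subnDA mulnA.
Qed.

(** The sum over i of the eigenvalues of the kernels K_i on the j-th Jacobi
    polynomial, weighted by 'C(M, 2 i). Only i = j + t with t >= 0 contributes,
    and in terms of t it is [vandermonde_sum] with L = M - 2 j and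
    nu = x + 2 j. *)
Lemma binomial_poch_sum M j x : 0 < x ->
  \sum_(i < M.+1) 'C(M, 2 * i)%:R * poch 2^-1 i * (i ^_ j)%:R /
     poch (x + 1) (i + j) =
  (if (2 * j <= M)%N then
     M`!%:R / (M - 2 * j)`!%:R * 2 ^+ M * poch (x + 2^-1) M /
     poch (2 * x + 1) (M + 2 * j) else 0) :> R.
Proof.
move=> x0; case: ifPn => [jM|]; last first.
  rewrite -ltnNge => Mj; apply: big1 => i _; have [ij|ji] := ltnP i j.
    by rewrite ffact_small// mulr0 mul0r.
  by rewrite bin_small ?mul0r// (leq_trans Mj)// leq_mul2l.
have jM1 : (j <= M.+1)%N by lia.
rewrite -(big_mkord xpredT (fun i => 'C(M, 2 * i)%:R * poch 2^-1 i *
  (i ^_ j)%:R / poch (x + 1) (i + j))) (@big_cat_nat _ _ _ j)//=.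
rewrite big_nat big1 => [|i /andP[_ ij]]; last first.
  by rewrite ffact_small// mulr0 mul0r.
rewrite add0r -{1}[j]add0n big_addn big_mkord.
set L := (M - 2 * j)%N; set nu := x + (2 * j)%:R.
have nu0 : 0 < nu by rewrite ltr_wpDr.
have fneq0 n : n`!%:R != 0 :> R by rewrite pnatr_eq0 -lt0n fact_gt0.
have p1 : poch (x + 1) (2 * j) != 0 by rewrite poch_neq0//; lra.
transitivity (M`!%:R / L`!%:R / (4 ^+ j * poch (x + 1) (2 * j)) *
    vandermonde_sum (M.+1 - j) L nu).
  rewrite /vandermonde_sum mulr_sumr; apply: eq_bigr => t _.
  have -> : poch (x + 1) (t + j + j) =
      poch (x + 1) (2 * j) * poch (nu + 1) t.
    rewrite -addnA addnC addnn -mul2n pochD; congr (_ * poch _ _).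
    by rewrite /nu; ring.
  have p2 : poch (nu + 1) t != 0 by rewrite poch_neq0//; lra.
  have := bin_ffact M (2 * (t + j)); have := poch_half (t + j).
  have := @ffact_fact (t + j) j (leq_addl _ _); rewrite addnK.
  have := @ffact_fact M (2 * j) jM; rewrite -/L.
  have := ffactD M (2 * j) (2 * t).
  rewrite -mulnDr addnC -/L => e1 e2 e3 e4 e5.
  have {}e2 := congr1 (fun n => n%:R : R) e2.
  have {}e3 := congr1 (fun n => n%:R : R) e3.
  have {}e5 := congr1 (fun n => n%:R : R) e5.
  move: e2 e3 e5; rewrite /= e1 !natrM -e4 => e2 e3 e5.
  have -> : 'C(M, 2 * (t + j))%:R * poch 2^-1 (t + j) * ((t + j) ^_ j)%:R =
      (M ^_ (2 * j))%:R * (L ^_ (2 * t))%:R / (4 ^+ t * 4 ^+ j * t`!%:R) :> R.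
    by rewrite -e5 -e3 exprD; field; rewrite fneq0 !expf_neq0//; lra.
  by rewrite -e2; field; rewrite !fneq0 p1 p2 !expf_neq0//; lra.
rewrite vandermonde_sumE//; last by rewrite /L; lia.
have -> : poch (x + 2^-1) M = poch (x + 2^-1) (2 * j) * poch (nu + 2^-1) L.
  rewrite -[in LHS](subnKC jM) pochD; congr (_ * poch _ _).
  by rewrite /nu; ring.
have -> : poch (2 * x + 1) (M + 2 * j) =
    4 ^+ (2 * j) * (poch (x + 2^-1) (2 * j) * poch (x + 1) (2 * j)) *
    poch (2 * nu + 1) L.
  have -> : (M + 2 * j = 2 * (2 * j) + L)%N by rewrite /L; lia.
  rewrite pochD (_ : 2 * x + 1 = 2 * (x + 2^-1)); last by field.
  rewrite poch_double (_ : x + 2^-1 + 2^-1 = x + 1); last by field.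
  congr (_ * poch _ _); rewrite /nu natrM; by field.
have -> : 2 ^+ M = 2 ^+ L * 4 ^+ j :> R.
  by rewrite -(subnKC jM) exprD mulrC exprM (_ : 2 ^+ 2 = 4 :> R)//; ring.
have p2 : poch (x + 2^-1) (2 * j) != 0 by rewrite poch_neq0//; lra.
have p3 : poch (2 * nu + 1) L != 0 by rewrite poch_neq0//; lra.
rewrite [4 ^+ (2 * j)]exprM (_ : 4 ^+ 2 = 4 * 4 :> R)// exprMn.
by field; rewrite !fneq0 p1 p2 p3 !expf_neq0//; lra.
Qed.

End Pochhammer.

(** * A kernel diagonalised by orthogonal polynomials *)

Section Bernstein.
Context {R : realFieldType}.
Implicit Types (al : R) (i d s : nat).

Definition half1pX : {poly R} := 2^-1 *: (1 + 'X).
Definition half1mX : {poly R} := 2^-1 *: (1 - 'X).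

Lemma half1pXDhalf1mX : half1pX + half1mX = 1.
Proof.
rewrite /half1pX /half1mX -scalerDr (_ : 1 + 'X + (1 - 'X) = 1 + 1); last by ring.
by rewrite -mulr2n -scalerMnr scalerMnl -mulr_natr mulVf ?scale1r ?pnatr_eq0.
Qed.

Lemma half1pXE x : half1pX.[x] = (1 + x) / 2.
Proof. by rewrite !hornerE mulrC. Qed.

Lemma half1mXE x : half1mX.[x] = (1 - x) / 2.
Proof. by rewrite !hornerE mulrC. Qed.

(** The size bounds below are upper bounds because the coefficient followed
    along may vanish (for d > i in [size_coef_bernstein]). *)
Lemma size_coef_half1pX_mul d (q : {poly R}) : (size q <= d.+1)%N ->
  (size (half1pX * q)%R <= d.+2)%N /\ (half1pX * q)`_d.+1 = q`_d / 2.
Proof.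
move=> sq; have -> : half1pX * q = 2^-1 *: (q + q * 'X).
  by rewrite /half1pX -scalerAl mulrDl mul1r ['X * q]mulrC.
split.
  apply: leq_trans (size_scale_leq _ _) _.
  apply: leq_trans (size_polyD _ _) _; rewrite geq_max.
  apply/andP; split; first exact: leqW.
  apply: leq_trans (size_polyMleq _ _) _.
  by rewrite size_polyX addnS addn1.
by rewrite coefZ coefD coefMX /= (nth_default _ sq) add0r mulrC.
Qed.

Lemma size_coef_half1pX_exp d : (size (half1pX ^+ d)%R <= d.+1)%N /\
  (half1pX ^+ d)`_d = 2^-1 ^+ d.
Proof.
elim: d => [|d [IHs IHc]].
  by rewrite !expr0 size_poly1 coef1.
rewrite exprS; have [-> ->] := size_coef_half1pX_mul IHs; split=> //.
by rewrite IHc exprSr.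
Qed.

(** The Bernstein operator of order i applied to the polynomial
    s |-> (al + s) (al + s + 1) ... (al + s + d - 1). *)
Definition bernstein i d al : {poly R} :=
  \sum_(s < i.+1)
    ('C(i, s)%:R * poch (al + s%:R) d) *: (half1pX ^+ s * half1mX ^+ (i - s)).

Lemma bernstein0r i al : bernstein i 0 al = 1.
Proof.
rewrite -[RHS](expr1n _ i) -half1pXDhalf1mX addrC exprDn.
apply: eq_bigr => s _.
by rewrite poch0 mulr1 scaler_nat mulrC.
Qed.

(** Splitting the first factor (al + s) as al plus s, and absorbing s in the
    binomial coefficient. *)
Lemma bernsteinSr i d al :
  bernstein i d.+1 al =
  al *: bernstein i d (al + 1) +
  i%:R *: (half1pX * bernstein i.-1 d (al + 2)).
Proof.
case: i => [|i] /=.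
  rewrite /bernstein !big_ord1 /= addr0 scale0r !addr0 pochS !subnn.
  by rewrite scalerA mulrCA.
transitivity (al *: bernstein i.+1 d (al + 1) +
  \sum_(s < i.+2) ('C(i.+1, s)%:R * s%:R * poch (al + 1 + s%:R) d) *:
    (half1pX ^+ s * half1mX ^+ (i.+1 - s))).
  rewrite /bernstein scaler_sumr -big_split /=; apply: eq_bigr => s _.
  rewrite scalerA -scalerDl pochS; congr (_ *: _).
  by rewrite (addrAC al s%:R); ring.
congr (_ + _); rewrite big_ord_recl /= mulr0 mul0r scale0r add0r.
rewrite /bernstein mulr_sumr scaler_sumr; apply: eq_bigr => s _.
rewrite /bump leq0n add1n subSS exprS -scalerAr scalerA -mulrA.
congr (_ *: _); last by rewrite mulrA.
rewrite !mulrA -!natrM [('C(_, _) * _)%N]mulnC -mul_bin_diag.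
by rewrite -natr1 (_ : al + 1 + (s%:R + 1) = al + 2 + s%:R)//; ring.
Qed.

(** Bernstein operators preserve the degree; here the coefficient of degree d
    is needed too, as it carries the eigenvalues of the kernels. *)
Lemma size_coef_bernstein i d al :
  (size (bernstein i d al) <= d.+1)%N /\
  (bernstein i d al)`_d = (i ^_ d)%:R / 2 ^+ d.
Proof.
elim: d i al => [|d IH] i al.
  by rewrite bernstein0r size_poly1 coef1 ffactn0 divr1.
rewrite bernsteinSr; have [s1 c1] := IH i (al + 1).
have [s2 c2] := IH i.-1 (al + 2); have [s3 c3] := size_coef_half1pX_mul s2.
split.
  apply: leq_trans (size_polyD _ _) _; rewrite geq_max.
  rewrite !(leq_trans (size_scale_leq _ _))//; exact: leqW.
rewrite coefD !coefZ c3 c2 nth_default// mulr0 add0r ffactnS natrM exprS.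
by rewrite [2 * 2 ^+ d]mulrC invfM !mulrA.
Qed.

End Bernstein.

Section Kernel.
Context {R : realFieldType}.
Variables (Lw : {scalar {poly R}}) (W a0 a1 : R) (p : nat -> {poly R}).
Hypothesis a0_gt0 : 0 < a0.
Hypothesis a1_gt0 : 0 < a1.
Hypothesis LwE : forall m n, Lw (half1pX ^+ m * half1mX ^+ n) =
  W * poch a0 m * poch a1 n / poch (a0 + a1) (m + n).
Hypothesis size_p : forall j, size (p j) = j.+1.
Hypothesis ortho_p : forall i j, Lw (p i * p j) = (i == j)%:R.

Implicit Types (i j d s : nat) (f g : {poly R}).

Let bmon i s : {poly R} := half1pX ^+ s * half1mX ^+ (i - s).

Definition kernel_coef i s : R :=
  poch 2^-1 i * 'C(i, s)%:R / (poch a0 s * poch a1 (i - s)).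

(** In the variable of the polynomial and in x this is K_i, symmetric in its two
    variables ([even_kernelE]). *)
Definition even_kernel i (x : R) : {poly R} :=
  \sum_(s < i.+1) (kernel_coef i s * (bmon i s).[x]) *: bmon i s.

(** The integral operator with kernel K_i, directly on polynomials; the
    functional [Lw] plays the role of integration against the weight. *)
Definition kernel_op i f : {poly R} :=
  \sum_(s < i.+1) (kernel_coef i s * Lw (bmon i s * f)) *: bmon i s.

Definition kernel_eigen i d : R :=
  W * poch 2^-1 i * (i ^_ d)%:R / poch (a0 + a1) (i + d).

Lemma Lw_kernel i x f : Lw (even_kernel i x * f) = (kernel_op i f).[x].
Proof.
rewrite /even_kernel /kernel_op mulr_suml linear_sum horner_sum.
apply: eq_bigr => s _; rewrite -scalerAl linearZ hornerZ /=.
by rewrite -!mulrA [_.[x] * _]mulrC.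
Qed.

Lemma kernel_op_sym i f g : Lw (kernel_op i f * g) = Lw (f * kernel_op i g).
Proof.
rewrite /kernel_op mulr_suml mulr_sumr !linear_sum.
apply: eq_bigr => s _; rewrite -scalerAl -scalerAr !linearZ /=.
by rewrite [f * _]mulrC mulrAC.
Qed.

Lemma kernel_opD i f g : kernel_op i (f + g) = kernel_op i f + kernel_op i g.
Proof.
rewrite /kernel_op -big_split; apply: eq_bigr => s _ /=.
by rewrite mulrDr linearD /= mulrDr scalerDl.
Qed.

Lemma kernel_opZ i c f : kernel_op i (c *: f) = c *: kernel_op i f.
Proof.
rewrite /kernel_op scaler_sumr; apply: eq_bigr => s _ /=.
by rewrite -scalerAr linearZ scalerA mulrCA.
Qed.

(** The Beta integrals in [LwE] cancel the denominators of [kernel_coef] and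
    leave a Bernstein sum. *)
Lemma kernel_op_half1pX i d : kernel_op i (half1pX ^+ d) =
  (W * poch 2^-1 i / poch (a0 + a1) (i + d)) *: bernstein i d a0.
Proof.
rewrite /kernel_op /bernstein scaler_sumr; apply: eq_bigr => s _.
rewrite scalerA; congr (_ *: _).
have si : (s <= i)%N by rewrite -ltnS.
rewrite /bmon [half1pX ^+ s * _ * _]mulrAC -exprD LwE pochD addnAC subnKC// /kernel_coef.
by field; rewrite !poch_neq0//= addr_gt0.
Qed.

(** Triangularity: powers of (1 + X) / 2 are a graded basis, so it is enough to
    know the operator on them. *)
Lemma size_coef_kernel_op i d f : (size f <= d.+1)%N ->
  (size (kernel_op i f) <= d.+1)%N /\
  (kernel_op i f)`_d = kernel_eigen i d * f`_d.
Proof.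
elim/ltn_ind: d f => d IH f sf.
have [sA cA] := @size_coef_half1pX_exp R d.
have [sB cB] := size_coef_bernstein i d a0.
(* Removing the leading part c * ((1 + X) / 2) ^ d leaves g of lower degree. *)
pose c := f`_d * 2 ^+ d; pose g := f - c *: half1pX ^+ d.
have sg : (size g <= d)%N.
  apply/leq_sizeP => k; rewrite leq_eqVlt => /predU1P[<-|dk].
    by rewrite coefB coefZ cA /c exprVn mulfK ?subrr// expf_neq0 ?pnatr_eq0.
  by rewrite coefB coefZ !nth_default ?mulr0 ?subrr// (leq_trans _ dk).
have sTg : (size (kernel_op i g) <= d)%N.
  case: d IH f sf @c @g sg {sA cA sB cB} => [|d] IH f sf c g sg.
    move: sg; rewrite leqn0 size_poly_eq0 => /eqP ->.
    by rewrite -(scale0r 0) kernel_opZ scale0r size_poly0.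
  by have [] := IH d (ltnSn _) g sg.
have -> : f = c *: half1pX ^+ d + g by rewrite addrC subrK.
move: c g sg sTg => {f sf} c g sg sTg.
rewrite kernel_opD kernel_opZ kernel_op_half1pX; split.
  apply: leq_trans (size_polyD _ _) _; rewrite geq_max (leqW sTg) andbT.
  by do 2! apply: leq_trans (size_scale_leq _ _) _.
rewrite !coefD !coefZ (nth_default _ sTg) (nth_default _ sg) cA cB.
rewrite /kernel_eigen !addr0 exprVn.
by field; rewrite !poch_neq0//= ?addr_gt0// expf_neq0 ?pnatr_eq0.
Qed.

Lemma span_p n f : (size f <= n)%N ->
  exists c : nat -> R, f = \sum_(j < n) c j *: p j.
Proof.
elim: n f => [|n IH] f sf.
  exists (fun=> 0); rewrite big_ord0; apply/eqP.
  by rewrite -size_poly_eq0 -leqn0.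
have pn0 : (p n)`_n != 0.
  have := lead_coef_eq0 (p n); rewrite lead_coefE size_p /= => ->.
  by rewrite -size_poly_eq0 size_p.
pose a := f`_n / (p n)`_n.
have [|c Hc] := IH (f - a *: p n).
  apply/leq_sizeP => k; rewrite leq_eqVlt => /predU1P[<-|nk].
    by rewrite coefB coefZ /a divfK// subrr.
  by rewrite coefB coefZ !nth_default ?mulr0 ?subrr// ?size_p ?(leq_trans _ nk).
exists (fun j => if j == n then a else c j).
rewrite big_ord_recr /= eqxx -[LHS](subrK (a *: p n)) Hc; congr (_ + _).
by apply: eq_bigr => j _; rewrite ltn_eqF.
Qed.

Lemma expand_p n f : (size f <= n)%N ->
  f = \sum_(j < n) Lw (f * p j) *: p j.
Proof.
move=> /span_p[c fE]; rewrite [LHS]fE; apply: eq_bigr => j _.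
congr (_ *: _); rewrite fE mulr_suml linear_sum /= (bigD1 j)//= big1.
  by rewrite -scalerAl linearZ /= ortho_p eqxx mulr1 addr0.
move=> k kj; rewrite -scalerAl linearZ /= ortho_p.
by rewrite (inj_eq val_inj) (negbTE kj) mulr0.
Qed.

Lemma ortho_low j f : (size f <= j)%N -> Lw (p j * f) = 0.
Proof.
move=> /expand_p ->; rewrite mulr_sumr linear_sum big1// => k _.
by rewrite -scalerAr linearZ /= ortho_p gtn_eqF// mulr0.
Qed.

(** A symmetric operator that does not raise degrees is diagonal in an
    orthonormal basis of polynomials of degrees 0, 1, 2, ... *)
Lemma kernel_op_p i j : kernel_op i (p j) = kernel_eigen i j *: p j.
Proof.
have [sT cT] : _ /\ _ := @size_coef_kernel_op i j (p j) (eq_leq (size_p j)).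
(* The components on p k with k < j vanish by symmetry and triangularity. *)
have TE : kernel_op i (p j) = Lw (kernel_op i (p j) * p j) *: p j.
  rewrite {1}(expand_p sT) big_ord_recr /= big1 ?add0r// => k _.
  rewrite kernel_op_sym ortho_low ?scale0r//.
  have [+ _] := @size_coef_kernel_op i k (p k) (eq_leq (size_p k)).
  by move=> /leq_trans; apply.
have pj0 : (p j)`_j != 0.
  have := lead_coef_eq0 (p j); rewrite lead_coefE size_p /= => ->.
  by rewrite -size_poly_eq0 size_p.
by move: cT; rewrite TE coefZ => /(mulIf pj0) <-.
Qed.

(** The eigenvalues vanish for j > i, so that one bound D can serve several
    kernels at once. *)
Lemma kernel_expand i D x y : (i < D)%N ->
  (even_kernel i x).[y] = \sum_(j < D) kernel_eigen i j * ((p j).[x] * (p j).[y]).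
Proof.
move=> iD; have sA (q : {poly R}) k : (size q <= 2)%N -> (size (q ^+ k)%R <= k.+1)%N.
  move=> sq; apply: leq_trans (size_poly_exp_leq _ _) _.
  by rewrite ltnS -[leqRHS]mul1n leq_mul2r orbC -subn1 leq_subLR sq.
have sA2 : (size (@half1pX R) <= 2)%N.
  by have [+ _] := @size_coef_half1pX_exp R 1; rewrite expr1.
have sB2 : (size (@half1mX R) <= 2)%N.
  have -> : @half1mX R = 1 - half1pX by rewrite -half1pXDhalf1mX addrC addKr.
  apply: leq_trans (size_polyD _ _) _.
  by rewrite size_polyN geq_max sA2 size_poly1.
have sK : (size (even_kernel i x) <= D)%N.
  apply: leq_trans (size_sum _ _ _) _; apply/bigmax_leqP => s _.
  apply: leq_trans (size_scale_leq _ _) _.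
  apply: leq_trans (size_polyMleq _ _) _.
  have := sA _ s sA2; have := sA _ (i - s)%N sB2; have := ltn_ord s.
  by move: (size _) (size _) => m n; lia.
rewrite (expand_p sK) horner_sum; apply: eq_bigr => j _.
by rewrite hornerZ Lw_kernel kernel_op_p hornerZ mulrA.
Qed.

Lemma even_kernelE i x y :
  (even_kernel i x).[y] = poch 2^-1 i * \sum_(s < i.+1)
    'C(i, s)%:R / (poch a0 s * poch a1 (i - s)) *
    ((1 + x) / 2 * ((1 + y) / 2)) ^+ s *
    ((1 - x) / 2 * ((1 - y) / 2)) ^+ (i - s).
Proof.
rewrite /even_kernel horner_sum mulr_sumr; apply: eq_bigr => s _.
rewrite hornerZ /bmon !hornerM !horner_exp !half1pXE !half1mXE /kernel_coef.
by rewrite !exprMn; ring.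
Qed.

End Kernel.

(** * Affine changes of variable and measures with density *)

Section affine_change_of_variable.
Local Open Scope ereal_scope.
Context {R : realType}.
Local Notation mu := lebesgue_measure.
Implicit Types f : R -> \bar R.

Lemma measurable_shift (d : R) :
  measurable_fun [set: R] ((fun x => x + d)%R : _ -> measurableTypeR R).
Proof. exact: measurable_funD. Qed.

Lemma measurable_scaling (c : R) :
  measurable_fun [set: R] ((fun x => c * x)%R : _ -> measurableTypeR R).
Proof. exact: measurable_funM. Qed.

Lemma ge0_integral_shift (d : R) f :
  measurable_fun [set: R] f -> (forall x, 0 <= f x) ->
  \int[mu]_x f (x + d)%R = \int[mu]_x f x.
Proof.
move=> mf f0.
transitivity (\int[pushforward mu
   ((fun x => x + d)%R : _ -> measurableTypeR R)]_x f x).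
  rewrite ge0_integral_pushforward//; exact: measurable_shift.
apply: eq_measure_integral; first exact: measurable_shift.
move=> Hyp0 A mA _; apply/esym.
apply: (lebesgue_measure_unique _ mA) => _ [[a b] _ <-].
rewrite /= /pushforward (_ : _ @^-1` _ = `](a - d)%R, (b - d)%R]%classic).
  by rewrite !lebesgue_measure_itv/= !lte_fin ltrD2r -!EFinB opprB addrA subrK.
by apply/seteqP; split => x /=; rewrite !in_itv/= ltrBlDr lerBrDr.
Qed.

Lemma ge0_integral_scale (c : R) f : (0 < c)%R ->
  measurable_fun [set: R] f -> (forall x, 0 <= f x) ->
  c%:E * \int[mu]_x f (c * x)%R = \int[mu]_x f x.
Proof.
move=> c0 mf f0.
pose nu : {measure set (measurableTypeR R) -> \bar R} :=
  measure_function_pushforward__canonical__measure_function_Measure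
    mu (measurable_scaling c).
transitivity (\int[mscale (NngNum (ltW c0)) nu]_x f x).
  rewrite ge0_integral_mscale//; congr (_ * _).
  by rewrite ge0_integral_pushforward//; exact: measurable_scaling.
apply: eq_measure_integral => A mA _; apply/esym.
apply: (lebesgue_measure_unique _ mA) => _ [[a b] _ <-].
rewrite /= /mscale/= /pushforward.
rewrite (_ : _ @^-1` _ = `](a / c)%R, (b / c)%R]%classic).
  rewrite !lebesgue_measure_itv/= !lte_fin ltr_pM2r ?invr_gt0//.
  case: ifPn => _; last by rewrite mule0.
  by rewrite -!EFinB -EFinM -mulrBl mulrC divfK ?gt_eqF.
apply/seteqP; split => x /=; rewrite !in_itv/= ltr_pdivrMr// ler_pdivlMr//.
  by rewrite ![(x * c)%R]mulrC.
by rewrite ![(x * c)%R]mulrC.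
Qed.

End affine_change_of_variable.

Section density.
Local Open Scope ereal_scope.
Context d (T : measurableType d) (R : realType).
Variables (mu nu : {measure set T -> \bar R}) (w : T -> R).
Hypothesis mw : measurable_fun [set: T] w.
Hypothesis w0 : forall x, (0 <= w x)%R.
Hypothesis nuE : forall A, measurable A -> nu A = \int[mu]_(x in A) (w x)%:E.

Import HBNNSimple.

(** Both sides agree on simple functions, and pass to increasing limits. *)
Lemma ge0_integral_density (f : T -> \bar R) :
  measurable_fun [set: T] f -> (forall x, 0 <= f x) ->
  \int[nu]_x f x = \int[mu]_x (f x * (w x)%:E).
Proof.
move=> mf f0; have mwE : measurable_fun setT (fun x => (w x)%:E).
  exact/measurable_EFinP.
pose h := nnsfun_approx measurableT mf.
have fE x : limn (fun n => (h n x)%:E) = f x.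
  by apply/cvg_lim => //; exact: cvg_nnsfun_approx.
transitivity (limn (fun n => \int[nu]_x (h n x)%:E)).
  rewrite -monotone_convergence//.
  - by apply: eq_integral => x _; rewrite -fE.
  - by move=> n; exact/measurable_EFinP.
  - by move=> n x _; rewrite lee_fin.
  - by move=> x _ a b ab; rewrite lee_fin; exact/lefP/nd_nnsfun_approx.
transitivity (limn (fun n => \int[mu]_x ((h n x)%:E * (w x)%:E))); last first.
  rewrite -monotone_convergence//.
  - apply: eq_integral => x _.
    apply/cvg_lim => //; apply: cvgeZr => //=.
    exact: cvg_nnsfun_approx.
  - by move=> n; apply: emeasurable_funM => //; exact/measurable_EFinP.
  - by move=> n x _; rewrite mule_ge0// lee_fin.
  - move=> x _ a b ab; apply: lee_wpmul2r; rewrite lee_fin//.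
    exact/lefP/nd_nnsfun_approx.
congr (limn _); apply/funext => n.
transitivity (\sum_(k \in range (h n)) \int[nu]_x (k * \1_(h n @^-1` [set k]) x)%:E).
  under eq_integral do rewrite fimfunE -fsumEFin//.
  rewrite ge0_integral_fsum//.
  - by move=> y; exact/measurable_EFinP/measurable_funM.
  - by move=> y x _; rewrite nnfun_muleindic_ge0.
transitivity (\sum_(k \in range (h n))
    \int[mu]_x ((k * \1_(h n @^-1` [set k]) x)%:E * (w x)%:E)); last first.
  rewrite -ge0_integral_fsum//.
  - apply: eq_integral => x _; rewrite fimfunE -fsumEFin// ge0_mule_fsuml//.
    by move=> r; rewrite nnfun_muleindic_ge0.
  - by move=> r; apply: emeasurable_funM => //; exact/measurable_EFinP/measurable_funM.
  - by move=> r x _; apply: mule_ge0; rewrite ?EFinM ?nnfun_muleindic_ge0 ?lee_fin.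
apply: eq_fsbigr => r; rewrite inE => -[t _ hr].
have r0 : (0 <= r)%R by rewrite -hr.
have mA : measurable (h n @^-1` [set r]) by [].
under eq_integral do rewrite EFinM.
rewrite ge0_integralZl//=; last first.
  exact/measurable_EFinP/measurable_indic.
rewrite integral_indic// setIT nuE// integral_mkcond.
under [in RHS]eq_integral do rewrite EFinM -muleA.
rewrite ge0_integralZl//=.
- congr (_ * _); apply: eq_integral => x _; rewrite patchE indicE.
  by case: ifPn => _; rewrite ?mul1e ?mul0e.
- by apply: emeasurable_funM => //; exact/measurable_EFinP/measurable_indic.
- by move=> x _; rewrite mule_ge0// lee_fin.
Qed.

End density.

(** * Euler's Gamma and Beta integrals *)

Section Euler_integrals.
Local Open Scope ereal_scope.
Context {R : realType}.
Local Notation mu := lebesgue_measure.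
Implicit Types a b t s : R.

(** The density t ^ (a - 1) on the half-line, extended by 0: all the integrals
    below are then over the whole line, where shifts and scalings are free. *)
Definition pospow a t : R := ((fun t => t `^ (a - 1))%R \_ `]0%R, +oo[) t.

Lemma pospow_gt0E a t : (0 < t)%R -> pospow a t = (t `^ (a - 1))%R.
Proof.
by move=> t0; rewrite /pospow patchE ifT// inE/= in_itv/= t0.
Qed.

Lemma pospow_le0E a t : (t <= 0)%R -> pospow a t = 0%R.
Proof.
by move=> t0; rewrite /pospow patchE ifF//; apply/negbTE;
  rewrite notin_setE/= in_itv/= ltNge t0.
Qed.

Lemma pospow_ge0 a t : (0 <= pospow a t)%R.
Proof.
have [t0|t0] := leP t 0%R; first by rewrite pospow_le0E.
by rewrite pospow_gt0E// powR_ge0.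
Qed.

Lemma measurable_pospow a : measurable_fun [set: R] (pospow a).
Proof.
apply/(measurable_restrictT _ _).1 => //.
by apply: measurable_funTS; exact: measurable_powR.
Qed.

Definition eGamma a : \bar R := \int[mu]_t (pospow a t * expR (- t))%:E.

(** B (a, b), since the integrand vanishes outside ]0, 1[. *)
Definition eBeta a b : \bar R := \int[mu]_y (pospow a y * pospow b (1 - y))%:E.

Lemma eGamma_ge0 a : 0 <= eGamma a.
Proof.
by apply: integral_ge0 => t _; rewrite lee_fin mulr_ge0 ?pospow_ge0 ?expR_ge0.
Qed.

Lemma eBeta_ge0 a b : 0 <= eBeta a b.
Proof. by apply: integral_ge0 => t _; rewrite lee_fin mulr_ge0 ?pospow_ge0. Qed.

Lemma measurable_pospow_comp a d (T : measurableType d) (f : T -> R) :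
  measurable_fun [set: T] f -> measurable_fun [set: T] (fun x => pospow a (f x)).
Proof. by move=> mf; apply: measurableT_comp => //; exact: measurable_pospow. Qed.

(** By homogeneity, scaling by u turns the convolution at u into that at 1. *)
Lemma pospow_convolution a b u : (0 < a)%R -> (0 < b)%R ->
  \int[mu]_s (pospow a s * pospow b (u - s))%:E =
  (pospow (a + b) u)%:E * eBeta a b.
Proof.
move=> a0 b0; have [u0|u0] := leP u 0%R.
  rewrite (pospow_le0E _ u0) mul0e; apply: integral0_eq => s _.
  have [s0|s0] := leP s 0%R; first by rewrite pospow_le0E// mul0r.
  by rewrite (pospow_le0E _ (_ : u - s <= 0)%R) ?mulr0//; lra.
rewrite -(ge0_integral_scale u0); first last.
- by move=> s; rewrite lee_fin mulr_ge0 ?pospow_ge0.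
- apply/measurable_EFinP/measurable_funM; first exact: measurable_pospow.
  by apply: measurable_pospow_comp; exact: measurable_funB.
transitivity (u%:E * \int[mu]_y
    ((u `^ (a - 1) * u `^ (b - 1))%:E * (pospow a y * pospow b (1 - y))%:E)).
  congr (_ * _); apply: eq_integral => y _; rewrite -EFinM; congr EFin.
  have [y0|y0] := leP y 0%R.
    by rewrite !(pospow_le0E a) ?mul0r ?mulr0// pmulr_rle0.
  have [y1|y1] := leP (1 - y)%R 0%R.
    rewrite !(pospow_le0E b) ?mulr0//.
    by rewrite -[X in (X - _)%R]mulr1 -mulrBr pmulr_rle0.
  have -> : (u - u * y = u * (1 - y))%R by ring.
  rewrite !pospow_gt0E ?mulr_gt0// !powRM ?ltW//; ring.
rewrite ge0_integralZl_EFin//; first last.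
- by rewrite mulr_ge0 ?powR_ge0.
- apply/measurable_EFinP/measurable_funM; first exact: measurable_pospow.
  by apply: measurable_pospow_comp; exact: measurable_funB.
- by move=> y _; rewrite lee_fin mulr_ge0 ?pospow_ge0.
rewrite muleA -EFinM pospow_gt0E//; congr (_%:E * _).
have u1 : u != 0%R by rewrite gt_eqF.
rewrite -{1}[u]powRr1 ?ltW// -!powRD ?u1 ?implybT//.
by congr powR; ring.
Qed.

(** The product of the two integrals is a double integral of
    s ^ (a - 1) t ^ (b - 1) exp (- s - t); the substitution u = s + t and
    Tonelli's theorem produce the convolution of the two densities. All values
    are in the extended reals, so no convergence has to be known beforehand. *)
Lemma eGamma_mul a b : (0 < a)%R -> (0 < b)%R ->
  eGamma a * eGamma b = eGamma (a + b) * eBeta a b.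
Proof.
move=> a0 b0.
pose F (z : measurableTypeR R * measurableTypeR R) : \bar R :=
  (pospow a z.1 * pospow b (z.2 - z.1) * expR (- z.2))%:E.
have mexp : measurable_fun [set: R] (fun t => expR (- t)).
  by apply: measurableT_comp => //; exact: measurable_expR.
have mg c : measurable_fun [set: R] (fun t => (pospow c t * expR (- t))%:E).
  by apply/measurable_EFinP/measurable_funM => //; exact: measurable_pospow.
have g0 c t : 0 <= (pospow c t * expR (- t))%:E.
  by rewrite lee_fin mulr_ge0 ?pospow_ge0 ?expR_ge0.
have F0 z : 0 <= F z by rewrite lee_fin !mulr_ge0 ?pospow_ge0 ?expR_ge0.
have mF : measurable_fun [set: _] F.
  apply/measurable_EFinP/measurable_funM; last first.
    by apply: (measurableT_comp mexp); exact: measurable_snd.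
  apply: measurable_funM; apply: measurable_pospow_comp.
    exact: measurable_fst.
  by apply: measurable_funB; [exact: measurable_snd|exact: measurable_fst].
transitivity (\int[mu]_s \int[mu]_u F (s, u)).
  rewrite /eGamma -ge0_integralZr ?eGamma_ge0//; last exact: mg.
  apply: eq_integral => s _.
  rewrite -ge0_integralZl//; last exact: mg.
  rewrite -(ge0_integral_shift s)//; last first.
    exact: measurableT_comp mF (measurable_pair1 s).
  apply: eq_integral => t _; rewrite /F -EFinM /=; congr EFin.
  by rewrite addrK opprD expRD; ring.
rewrite (fubini_tonelli F)//.
rewrite /eGamma -ge0_integralZr ?eBeta_ge0//; last exact: mg.
apply: eq_integral => u _; rewrite /F /=.
under eq_integral do rewrite EFinM muleC.
rewrite ge0_integralZl_EFin; first last.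
- exact: expR_ge0.
- apply/measurable_EFinP/measurable_funM; first exact: measurable_pospow.
  by apply: measurable_pospow_comp; exact: measurable_funB.
- by move=> y _; rewrite lee_fin mulr_ge0 ?pospow_ge0.
- exact: measurableT.
by rewrite pospow_convolution// muleA -EFinM mulrC.
Qed.

(** Cut off at e to keep away from the singularity at 0 when a < 1. *)
Lemma integral_powR_ge a e : (0 < a)%R -> (0 < e < 1)%R ->
  \int[mu]_(y in `[e, 1%R]) (y `^ (a - 1))%:E = ((1 - e `^ a) / a)%:E.
Proof.
move=> a0 /andP[e0 e1].
have cont (c x : R) : (0 < x)%R -> {for x, continuous (@powR R ^~ c)}.
  move=> x0; apply/differentiable_continuous/derivable1_diffP.
  by apply: derivable_powR; rewrite in_itv/= x0.
rewrite (@continuous_FTC2 _ _ (fun y => a^-1 * y `^ a)%R)//.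
- by rewrite -EFinB powR1; congr EFin; field; rewrite gt_eqF.
- apply: continuous_in_subspaceT => x; rewrite inE/= in_itv/= => /andP[ex _].
  by apply: cont; exact: lt_le_trans ex.
- split.
  + move=> x; rewrite in_itv/= => /andP[ex _].
    apply: derivableM => //; apply: derivable_powR.
    by rewrite in_itv/= (lt_trans e0).
  + apply: cvg_at_right_filter; apply: cvgM; first exact: cvg_cst.
    exact: cont.
  + apply: cvg_at_left_filter; apply: cvgM; first exact: cvg_cst.
    exact: cont.
- move=> x; rewrite in_itv/= => /andP[ex _].
  have x0 : (0 < x)%R by exact: lt_trans ex.
  rewrite derive1E deriveM//; last first.
    by apply: derivable_powR; rewrite in_itv/= x0.
  rewrite derive_cst scaler0 addr0 -derive1E powR_derive1 ?in_itv/= ?x0//.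
  by rewrite /GRing.scale/= mulrA mulVf ?mul1r// gt_eqF.
Qed.

Lemma eBeta1 a : (0 < a)%R -> eBeta a 1 = (a^-1)%:E.
Proof.
move=> a0.
transitivity (\int[mu]_(y in `]0%R, 1%R]) (y `^ (a - 1))%:E).
  rewrite integral_itv_bndoo; last first.
    by apply/measurable_EFinP; apply: measurable_funTS; exact: measurable_powR.
  rewrite integral_mkcond; apply: eq_integral => y _.
  rewrite patchE; case: ifPn; rewrite ?notin_setE ?inE/= in_itv/=.
    move=> /andP[y0 y1]; rewrite !pospow_gt0E ?subr_gt0//.
    by rewrite subrr powRr0 mulr1.
  move/negP; rewrite negb_and -!leNgt => /orP[y0|y1].
    by rewrite pospow_le0E// mul0r.
  by rewrite (@pospow_le0E 1) ?mulr0// subr_le0.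
pose F (n : nat) : set R := `[(n.+2%:R^-1)%R, 1%R]%classic.
have -> : `]0%R, 1%R]%classic = \bigcup_n F n.
  apply/seteqP; split => [x|x [n _]]; rewrite /F /= !in_itv/=.
    move=> /andP[x0 x1]; have [n nx] : exists n, (n.+2%:R^-1 <= x)%R.
      have := ltW (truncnS_gt x^-1); move: (Num.truncn _) => n nx.
      exists n; rewrite invf_ple ?posrE ?ltr0n//.
      by apply: le_trans nx _; rewrite ler_nat.
    by exists n => //; rewrite /= in_itv/= nx.
  by move=> /andP[nx ->]; rewrite andbT (lt_le_trans _ nx)// invr_gt0.
have Fcvg := @ge0_nondecreasing_set_cvg_integral _ (measurableTypeR R) R F
  (fun y => (y `^ (a - 1))%:E) (@lebesgue_measure R).
apply: cvg_unique (Fcvg _ _ _ _) _ => //.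
- move=> m n mn; apply/subsetPset => x; rewrite /F /= !in_itv/=.
  move=> /andP[mx ->]; rewrite andbT (le_trans _ mx)//.
  by rewrite lef_pV2 ?posrE// ler_nat !ltnS.
- by move=> n; exact: measurable_itv.
- move=> n; apply/measurable_EFinP; apply: measurable_funTS.
  exact: measurable_powR.
- by move=> n x _; rewrite lee_fin powR_ge0.
rewrite (_ : (fun i => _) = fun i =>
    ((1 - (i.+2%:R^-1) `^ a) / a)%:E); last first.
  apply/funext => i; apply: integral_powR_ge => //.
  by rewrite invr_gt0 ltr0n/= invf_lt1// ltr1n.
apply: cvg_EFin; first exact: nearW.
have inv_cvg : ((fun i => i.+2%:R^-1 : R) @ \oo --> (0 : R)^'+)%R.
  move=> P; rewrite /at_right/within/= => nP.
  have c : ((fun i => i.+2%:R^-1 : R) @ \oo --> (0 : R))%R.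
    by have := @cvg_harmonic R; rewrite -cvg_shiftS.
  have [N _ HN] := c _ nP; exists N => // i Ni.
  by apply: (HN i Ni); rewrite invr_gt0 ltr0n.
have h : ((1 - (i.+2%:R^-1) `^ a)%R @[i --> \oo] --> (1 - 0 : R))%R.
  apply: cvgB; first exact: cvg_cst.
  exact: cvg_comp inv_cvg (powR_cvg0 a0).
rewrite subr0 in h; rewrite -[X in _ --> X]mul1r; exact: cvgMr_tmp h.
Qed.

Lemma eGamma1 : eGamma 1 = 1.
Proof.
rewrite /eGamma -(@integral_exponential_pdf R 1 ltr01).
rewrite [LHS](_ : _ = \int[mu]_(t in `]0%R, +oo[) (expR (- t))%:E); last first.
  rewrite [RHS]integral_mkcond; apply: eq_integral => t _.
  rewrite patchE; case: ifPn; rewrite ?notin_setE ?inE/= in_itv/= andbT.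
    by move=> t0; rewrite pospow_gt0E// subrr powRr0 mul1r.
  by move/negP; rewrite -leNgt => t0; rewrite pospow_le0E// mul0r.
rewrite integral_itv_obnd_cbnd; last first.
  apply/measurable_EFinP; apply: measurable_funTS.
  by apply: measurableT_comp => //; exact: measurable_expR.
rewrite integral_mkcond; apply: eq_integral => t _.
rewrite patchE; case: ifPn; rewrite ?notin_setE ?inE/= in_itv/= andbT => t0.
  by rewrite exponential_pdfE//= mul1r mulN1r.
by rewrite lt0_exponential_pdf// ltNge; exact/negP.
Qed.

Lemma eGammaS a : (0 < a)%R -> eGamma (a + 1) = a%:E * eGamma a.
Proof.
move=> a0; have := eGamma_mul a0 ltr01.
rewrite eGamma1 mule1 eBeta1// => ->.
by rewrite muleCA -EFinM divff ?mule1// gt_eqF.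
Qed.

(** Integer values are finite by the functional equation; t ^ a is at most
    1 + t ^ (n + 1) for n + 1 >= a, and the functional equation brings a + 1
    back to a. *)
Lemma eGamma_ltpinfty a : (0 < a)%R -> eGamma a < +oo.
Proof.
have eGn n : eGamma n.+1%:R < +oo.
  elim: n => [|n IH]; first by rewrite eGamma1 ltry.
  rewrite -natr1 eGammaS ?ltr0n// lte_mul_pinfty//.
move=> a0.
have mg c : measurable_fun [set: R] (fun t => (pospow c t * expR (- t))%:E).
  apply/measurable_EFinP/measurable_funM; first exact: measurable_pospow.
  by apply: measurableT_comp => //; exact: measurable_expR.
have g0 c t : 0 <= (pospow c t * expR (- t))%:E.
  by rewrite lee_fin mulr_ge0 ?pospow_ge0 ?expR_ge0.
suff : eGamma (a + 1) < +oo.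
  rewrite eGammaS//; have := eGamma_ge0 a.
  case: (eGamma a) => [r _ _||]//=; first exact: ltry.
  by move=> _; rewrite gt0_muley ?lte_fin.
have := ltW (truncnS_gt a); move: (Num.truncn a) => n an.
apply: (@le_lt_trans _ _ (eGamma 1 + eGamma n.+2%:R)); last first.
  by rewrite lte_add_pinfty// eGamma1 ltry.
rewrite /eGamma -ge0_integralD//; [|exact: mg..].
apply: ge0_le_integral => //.
- exact: mg.
- by apply: emeasurable_funD; exact: mg.
move=> t _; rewrite -EFinD lee_fin -mulrDl ler_wpM2r ?expR_ge0//.
have [t0|t0] := leP t 0%R; first by rewrite !pospow_le0E ?addr0.
rewrite !pospow_gt0E// addrK subrr powRr0 -natr1 addrK.
have [t1|t1] := leP t 1%R.
  rewrite -[leLHS]addr0 lerD ?powR_ge0//.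
  have <- : (1 `^ a = 1 :> R)%R by rewrite powR1.
  by apply: ge0_ler_powR; rewrite ?nnegrE ?ler01 ?(ltW a0) ?(ltW t0).
rewrite -[leLHS]add0r lerD ?ler01// ler_powR//; exact: ltW.
Qed.

Lemma Gamma_fine a : Gamma a = fine (eGamma a).
Proof.
rewrite /Gamma /Rintegral integral_mkcond; congr fine.
apply: eq_integral => t _; rewrite /pospow !patchE.
by case: ifPn => _//; rewrite mul0r.
Qed.

Lemma eGammaE a : (0 < a)%R -> eGamma a = (Gamma a)%:E.
Proof.
move=> a0; rewrite Gamma_fine fineK// ge0_fin_numE ?eGamma_ge0//.
exact: eGamma_ltpinfty.
Qed.

Lemma GammaS a : (0 < a)%R -> Gamma (a + 1) = (a * Gamma a)%R.
Proof.
move=> a0; apply: EFin_inj.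
by rewrite EFinM -!eGammaE ?eGammaS// addr_gt0.
Qed.

(** After a shift by 1, the integrand of Gamma (a + 1) is at least exp (- 2) on
    [1, 2]. *)
Lemma Gamma_gt0 a : (0 < a)%R -> (0 < Gamma a)%R.
Proof.
move=> a0; suff : (0 < Gamma (a + 1))%R by rewrite GammaS// pmulr_rgt0.
rewrite -lte_fin -eGammaE ?addr_gt0//.
apply: (@lt_le_trans _ _ (\int[mu]_(t in `[1%R, 2%R]) (expR (- 2))%:E)).
  rewrite integral_cst//= lebesgue_measure_itv/= lte_fin ltr1n//=.
  by rewrite -EFinB -EFinM lte_fin mulr_gt0 ?expR_gt0// subr_gt0 ltr1n.
rewrite integral_mkcond; apply: ge0_le_integral => //.
- by move=> t _; apply: erestrict_ge0 => s _; rewrite lee_fin expR_ge0.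
- by apply/(measurable_restrictT _ _).1 => //; exact: measurable_cst.
- apply/measurable_EFinP/measurable_funM; first exact: measurable_pospow.
  by apply: measurableT_comp => //; exact: measurable_expR.
move=> t _; rewrite patchE; case: ifPn => [|_]; last first.
  by rewrite lee_fin mulr_ge0 ?pospow_ge0 ?expR_ge0.
rewrite inE/= in_itv/= => /andP[t1 t2].
rewrite lee_fin -[leLHS]mul1r ler_pM ?expR_ge0 ?ler_expR ?lerN2//.
rewrite pospow_gt0E ?(lt_le_trans _ t1)// addrK.
have <- : (1 `^ a = 1 :> R)%R by rewrite powR1.
by apply: ge0_ler_powR; rewrite ?nnegrE ?ler01 ?(ltW a0) ?(le_trans ler01 t1).
Qed.

Lemma eBetaE a b : (0 < a)%R -> (0 < b)%R ->
  eBeta a b = (Gamma a * Gamma b / Gamma (a + b))%:E.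
Proof.
move=> a0 b0; have ab0 := addr_gt0 a0 b0; have := eGamma_mul a0 b0.
rewrite !eGammaE//; have := eBeta_ge0 a b; have := Gamma_gt0 ab0.
case: (eBeta a b) => [B||]//= G0 _.
  rewrite -!EFinM => -[->]; congr EFin.
  by rewrite mulrAC mulfV ?mul1r// gt_eqF.
by rewrite -EFinM gt0_muley ?lte_fin.
Qed.

Lemma integral_jacobi_weight a b : (0 < a)%R -> (0 < b)%R ->
  \int[mu]_s (pospow a (1 + s) * pospow b (1 - s))%:E =
  (2 `^ (a + b - 1) * (Gamma a * Gamma b / Gamma (a + b)))%:E.
Proof.
move=> a0 b0; rewrite EFinM -eBetaE//.
have mw : measurable_fun [set: R]
    (fun s => (pospow a (1 + s) * pospow b (1 - s))%:E).
  apply/measurable_EFinP/measurable_funM; apply: measurable_pospow_comp.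
    exact: measurable_funD.
  exact: measurable_funB.
have w0 s : 0 <= (pospow a (1 + s) * pospow b (1 - s))%:E.
  by rewrite lee_fin mulr_ge0 ?pospow_ge0.
have mw' : measurable_fun [set: R]
    (fun s => (pospow a (1 + (s - 1)) * pospow b (1 - (s - 1)))%:E).
  apply: (measurableT_comp mw); exact: measurable_funB.
rewrite -(ge0_integral_shift (-1) mw w0).
rewrite -(ge0_integral_scale (@ltr0Sn R 1) mw' (fun s => w0 _)).
transitivity (2%:E * \int[mu]_y ((2 `^ (a - 1) * 2 `^ (b - 1))%:E *
    (pospow a y * pospow b (1 - y))%:E)).
  congr (_ * _); apply: eq_integral => y _; rewrite -EFinM; congr EFin.
  have -> : (1 + (2 * y - 1) = 2 * y)%R by ring.
  have -> : (1 - (2 * y - 1) = 2 * (1 - y))%R by ring.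
  have [y0|y0] := leP y 0%R.
    by rewrite !(pospow_le0E a) ?mul0r ?mulr0// pmulr_rle0.
  have [y1|y1] := leP (1 - y)%R 0%R.
    by rewrite !(pospow_le0E b) ?mulr0// pmulr_rle0.
  rewrite !pospow_gt0E ?mulr_gt0// !powRM ?ltW//; ring.
rewrite ge0_integralZl_EFin; first last.
- by rewrite mulr_ge0 ?powR_ge0.
- apply/measurable_EFinP/measurable_funM; first exact: measurable_pospow.
  by apply: measurable_pospow_comp; exact: measurable_funB.
- by move=> y _; rewrite lee_fin mulr_ge0 ?pospow_ge0.
- exact: measurableT.
rewrite muleA -EFinM; congr (_%:E * _).
have u1 : (2 != 0 :> R)%R by rewrite pnatr_eq0.
rewrite -{1}[2%R](@powRr1 R) ?ler0n// -!powRD ?u1 ?implybT//.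
by congr powR; ring.
Qed.

End Euler_integrals.

(** * The Jacobi moment functional *)

Section jacobi_functional.
Context {R : realType}.
Local Notation mu := lebesgue_measure.
Implicit Types (a b k s nu : R) (q f g : {poly R}).

(** The weight (1 + s) ^ (a - 1) (1 - s) ^ (b - 1), zero outside ]- 1, 1[. *)
Definition jacobi_weight a b s : R := pospow a (1 + s) * pospow b (1 - s).

Definition jacobi_mass a b : R :=
  2 `^ (a + b - 1) * (Gamma a * Gamma b / Gamma (a + b)).

Lemma jacobi_mass_gt0 a b : 0 < a -> 0 < b -> 0 < jacobi_mass a b.
Proof.
move=> a0 b0; rewrite mulr_gt0 ?powR_gt0// divr_gt0 ?mulr_gt0 ?Gamma_gt0//.
exact: addr_gt0.
Qed.

Lemma jacobi_weight_ge0 a b s : 0 <= jacobi_weight a b s.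
Proof. by rewrite mulr_ge0 ?pospow_ge0. Qed.

Lemma measurable_jacobi_weight a b :
  measurable_fun [set: R] (jacobi_weight a b).
Proof.
apply: measurable_funM; apply: measurable_pospow_comp.
  exact: measurable_funD.
exact: measurable_funB.
Qed.

Lemma measurable_poly q : measurable_fun [set: R] (horner q).
Proof.
by apply: continuous_measurable_fun => x; exact: continuous_horner.
Qed.

Lemma jacobi_weight_out a b s : 1 <= `|s| -> jacobi_weight a b s = 0.
Proof.
rewrite /jacobi_weight; have [s0|s0] := leP 0 s.
  rewrite ger0_norm// => s1; rewrite (@pospow_le0E _ b) ?mulr0//; lra.
rewrite ltr0_norm// => s1; rewrite (@pospow_le0E _ a) ?mul0r//; lra.
Qed.

Lemma poly_bounded q : exists M : R, forall s, `|s| <= 1 -> `|q.[s]| <= M.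
Proof.
exists (\sum_(i < size q) `|q`_i|) => s s1; rewrite horner_coef.
apply: le_trans (ler_norm_sum _ _ _) _; apply: ler_sum => i _.
rewrite normrM -[leRHS]mulr1 ler_wpM2l// normrX exprn_ile1//.
Qed.

Lemma integrable_jacobi a b q : 0 < a -> 0 < b ->
  mu.-integrable [set: R] (fun s => (q.[s] * jacobi_weight a b s)%:E).
Proof.
move=> a0 b0; have [M qM] := poly_bounded q.
have {}qM (s : R) : `|q.[s] * jacobi_weight a b s| <= `|M * jacobi_weight a b s|.
  have [s1|s1] := leP `|s| 1; last by rewrite jacobi_weight_out ?mulr0// ltW.
  by rewrite normrM [leRHS]normrM ler_wpM2r// (le_trans (qM _ s1))// ler_norm.
have mw : measurable_fun [set: R] (fun s => (jacobi_weight a b s)%:E).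
  by apply/measurable_EFinP; exact: measurable_jacobi_weight.
have iw : mu.-integrable [set: R] (fun s => (jacobi_weight a b s)%:E).
  apply/integrableP; split => //.
  under eq_integral do rewrite gee0_abs ?lee_fin ?jacobi_weight_ge0//.
  by rewrite integral_jacobi_weight// ltry.
apply: (le_integrable measurableT _ _ (integrableZl measurableT M iw)).
- apply/measurable_EFinP/measurable_funM; first exact: measurable_poly.
  exact: measurable_jacobi_weight.
- by move=> s _; rewrite -EFinM !abse_EFin lee_fin.
Qed.

Definition jacobi_form a b q : R :=
  Rintegral mu [set: R] (fun s => q.[s] * jacobi_weight a b s).

Lemma jacobi_formE a b q : 0 < a -> 0 < b ->
  (\int[mu]_s (q.[s] * jacobi_weight a b s)%:E)%E = (jacobi_form a b q)%:E.
Proof.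
move=> a0 b0; rewrite /jacobi_form /Rintegral fineK//.
exact: integrable_fin_num (integrable_jacobi _ a0 b0).
Qed.

Lemma jacobi_form_linear a b : 0 < a -> 0 < b ->
  scalar (jacobi_form a b).
Proof.
move=> a0 b0 c f g; rewrite /jacobi_form.
transitivity (Rintegral mu [set: R] (fun s =>
   c * (f.[s] * jacobi_weight a b s) + g.[s] * jacobi_weight a b s)).
  congr fine; apply: eq_integral => s _ /=; congr EFin.
  by rewrite hornerD hornerZ mulrDl mulrA.
have iZ := integrable_jacobi (c *: f) a0 b0.
rewrite RintegralD//; last exact: integrable_jacobi.
  by rewrite RintegralZl//; exact: integrable_jacobi.
apply: eq_integrable iZ => // s _ /=.
by rewrite hornerZ mulrA.
Qed.

Definition jacobi_scalar a b (a0 : 0 < a) (b0 : 0 < b) : {scalar {poly R}} :=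
  HB.pack (jacobi_form a b)
    (GRing.isLinear.Build R {poly R} R _ (jacobi_form a b)
       (jacobi_form_linear a0 b0)).

Lemma Gamma_poch a n : 0 < a -> Gamma (a + n%:R) = poch a n * Gamma a.
Proof.
move=> a0; elim: n => [|n IH]; first by rewrite addr0 poch0 mul1r.
have an0 : 0 < a + n%:R by rewrite ltr_wpDr.
by rewrite -natr1 addrA (GammaS an0) IH pochSr mulrA [(a + _) * _]mulrC.
Qed.

(** Powers of (1 + X) / 2 and (1 - X) / 2 are absorbed by the weight. *)
Lemma jacobi_form_shift a b m n q : 0 < a -> 0 < b ->
  jacobi_form a b (half1pX ^+ m * half1mX ^+ n * q) =
  (2 ^+ (m + n))^-1 * jacobi_form (a + m%:R) (b + n%:R) q.
Proof.
move=> a0 b0.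
have am0 : 0 < a + m%:R by rewrite ltr_wpDr.
have bn0 : 0 < b + n%:R by rewrite ltr_wpDr.
rewrite /jacobi_form -RintegralZl//; last exact: integrable_jacobi.
congr fine; apply: eq_integral => s _; congr EFin.
rewrite hornerM hornerM !horner_exp half1pXE half1mXE /jacobi_weight.
have [s0|s0] := leP (1 + s) 0.
  by rewrite !(pospow_le0E _ s0) !mul0r !mulr0.
have [s1|s1] := leP (1 - s) 0.
  by rewrite !(pospow_le0E _ s1) !mulr0.
rewrite !pospow_gt0E// !(addrAC _ _ (- 1)) !powRD ?(gt_eqF s0) ?(gt_eqF s1) ?implybT//.
rewrite !powR_mulrn ?ltW// !expr_div_n exprD invfM; ring.
Qed.

Lemma jacobi_form1 a b : 0 < a -> 0 < b ->
  jacobi_form a b 1 = jacobi_mass a b.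
Proof.
move=> a0 b0; apply: EFin_inj; rewrite -jacobi_formE// -integral_jacobi_weight//.
by apply: eq_integral => s _; rewrite hornerC mul1r.
Qed.

Lemma jacobi_massD a b m n : 0 < a -> 0 < b ->
  jacobi_mass (a + m%:R) (b + n%:R) =
  2 ^+ (m + n) * (jacobi_mass a b * poch a m * poch b n / poch (a + b) (m + n)).
Proof.
move=> a0 b0; rewrite /jacobi_mass !Gamma_poch//.
have -> : a + m%:R + (b + n%:R) = a + b + (m + n)%:R by rewrite natrD; ring.
rewrite Gamma_poch ?addr_gt0//.
rewrite (addrAC _ _ (-1)) [in LHS]powRD ?pnatr_eq0 ?implybT//.
rewrite powR_mulrn ?ler0n//.
have := @poch_neq0 _ (a + b) (m + n) (addr_gt0 a0 b0).
have := Gamma_gt0 (addr_gt0 a0 b0).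
move: (Gamma _) (Gamma _) (Gamma _) (poch _ _) (_ `^ _) (_ ^+ _).
move=> G1 G2 G3 P E1 E2 /gt_eqF/negbT G0 p0.
by field; rewrite p0 G0.
Qed.

Lemma jacobi_form_half1pX_half1mX a b m n : 0 < a -> 0 < b ->
  jacobi_form a b (half1pX ^+ m * half1mX ^+ n) =
  jacobi_mass a b * poch a m * poch b n / poch (a + b) (m + n).
Proof.
move=> a0 b0; rewrite -[_ * _ in LHS]mulr1 jacobi_form_shift//.
rewrite jacobi_form1 ?ltr_wpDr// jacobi_massD// mulKf ?expf_neq0 ?pnatr_eq0//.
Qed.

(** The two weights differ at most at the endpoints, which form a null set. *)
Lemma integral_jacobi_itv a b q : 0 < a -> 0 < b ->
  (\int[mu]_(s in `[(-1)%R, 1%R])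
     (q.[s] * ((1 - s) `^ (b - 1) * (1 + s) `^ (a - 1)))%:E)%E =
  (jacobi_form a b q)%:E.
Proof.
move=> a0 b0; rewrite integral_itv_bndoo; last first.
  apply/measurable_EFinP; apply: measurable_funTS; apply: measurable_funM.
    exact: measurable_poly.
  apply: measurable_funM; apply: (measurableT_comp (measurable_powR _)).
    exact: measurable_funB.
  exact: measurable_funD.
rewrite -jacobi_formE// integral_mkcond; apply: eq_integral => s _.
rewrite patchE; case: ifPn; rewrite ?notin_setE ?inE/= in_itv/=.
  move=> /andP[s1 s2]; rewrite /jacobi_weight !pospow_gt0E ?subr_gt0//; last lra.
  by rewrite [_ * (1 + s) `^ _]mulrC.
move/negP; rewrite -ltr_norml -leNgt => s1.
by rewrite jacobi_weight_out// mulr0.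
Qed.

End jacobi_functional.

(** * Moments of the symmetric Beta measures *)

Section symmetric_beta_moments.
Context {R : realType}.
Local Notation mu := lebesgue_measure.
Implicit Types (k u : R) (q f g : {poly R}).

Lemma symmetric_weightE k u : u \in `[(-1)%R, 1%R] ->
  (1 - u ^+ 2) `^ (k - 2^-1 - 2^-1) = (1 - u) `^ (k - 1) * (1 + u) `^ (k - 1).
Proof.
rewrite in_itv/= => /andP[u1 u2].
rewrite -powRM; [|lra|lra].
by congr powR; [ring|field].
Qed.

Lemma sym_beta_massT k : 0 < k ->
  sym_beta_mass (k - 2^-1) [set: measurableTypeR R] = (jacobi_mass k k)%:E.
Proof.
move=> k0; rewrite -jacobi_form1// -integral_jacobi_itv//.
rewrite [RHS]integral_mkcond; apply: eq_integral => u _.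
rewrite /sym_beta_weight !patchE; case: ifPn => //.
rewrite inE /= => u1; congr EFin.
by rewrite symmetric_weightE// hornerC mul1r.
Qed.

Lemma sym_betaE k (A : set (measurableTypeR R)) : 0 < k ->
  sym_beta (k - 2^-1) A =
  (sym_beta_mass (k - 2^-1) A * ((jacobi_mass k k)^-1)%:E)%E.
Proof.
move=> k0; transitivity (let e := sym_beta_mass (k - 2^-1) [set: measurableTypeR R] in
  (if (e == 0%E) || (e == +oo%E) then fun U => \d_(0 : measurableTypeR R) U
   else fun U => (sym_beta_mass (k - 2^-1) U * ((fine e)^-1)%:E)%E) A) => //.
by rewrite sym_beta_massT//= eqe gt_eqF ?jacobi_mass_gt0.
Qed.

Lemma integral_sym_beta k q : 0 < k ->
  (forall u, u \in `[(-1)%R, 1%R] -> 0 <= q.[u]) ->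
  (\int[sym_beta (k - 2^-1)]_(u in `[(-1)%R, 1%R]) (q.[u])%:E =
   (jacobi_form k k q / jacobi_mass k k)%:E)%E.
Proof.
move=> k0 q0; have jm0 := jacobi_mass_gt0 k0 k0.
pose w : R -> R := fun s => ((fun t => (1 - t ^+ 2) `^ (k - 2^-1 - 2^-1)) \_
  `[(-1)%R, 1%R]) s.
have mwE : measurable_fun [set: R] (fun s => (w s)%:E).
  exact: measurable_sym_beta_weight.
have mw : measurable_fun [set: R] w by exact/measurable_EFinP.
have w0 s : 0 <= w s by have := @sym_beta_weight_ge0 _ (k - 2^-1) s.
rewrite integral_mkcond.
rewrite (@ge0_integral_density _ _ _ mu (sym_beta (k - 2^-1))
   (fun s => w s / jacobi_mass k k)); first last.
- by move=> u; apply: erestrict_ge0 => v /= v1; rewrite lee_fin q0.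
- apply/(measurable_restrictT _ _).1 => //; apply/measurable_EFinP.
  by apply: measurable_funTS; exact: measurable_poly.
- move=> A mA; apply: etrans; first exact: sym_betaE.
  rewrite /sym_beta_mass.
  rewrite -ge0_integralZr; first last.
  + by rewrite lee_fin invr_ge0 ltW.
  + by move=> x _; exact: sym_beta_weight_ge0.
  + exact: measurable_funTS.
  + exact: mA.
  by apply: eq_integral => x _; rewrite EFinM.
- by move=> x; rewrite divr_ge0// ltW.
- exact: measurable_funM.
rewrite mulrC EFinM -integral_jacobi_itv//.
rewrite -ge0_integralZl; first last.
- by rewrite lee_fin invr_ge0 ltW.
- move=> x x1; rewrite lee_fin mulr_ge0 ?q0// mulr_ge0 ?powR_ge0//.
- apply/measurable_EFinP; apply: measurable_funTS; apply: measurable_funM.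
    exact: measurable_poly.
  apply: measurable_funM; apply: (measurableT_comp (measurable_powR _)).
    exact: measurable_funB.
  exact: measurable_funD.
- exact: measurable_itv.
rewrite [RHS]integral_mkcond; apply: eq_integral => u _.
rewrite !patchE; case: ifPn => u1; last by rewrite mul0e.
rewrite /w patchE u1 -!EFinM; congr EFin.
by rewrite symmetric_weightE ?(set_mem u1)// mulrA mulrC.
Qed.

(** The n-th moment of the symmetric Beta measure with k = nu + 1 / 2 (see
    [integral_sym_beta] and [jacobi_form_monomial]). *)
Definition beta_moment k (n : nat) : R :=
  if odd n then 0 else poch 2^-1 n./2 / poch (k + 2^-1) n./2.

Lemma jacobi_form_1subX2 k q : 0 < k ->
  jacobi_form k k ((1 - 'X^2) * q) = jacobi_form (k + 1) (k + 1) q.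
Proof.
move=> k0; have /= lin := jacobi_scalar k0 k0.
have -> : (1 - 'X^2) * q = 4 *: (half1pX ^+ 1 * half1mX ^+ 1 * q) :> {poly R}.
  rewrite !expr1 /half1pX /half1mX -!scalerAl -scalerAr -scalerAl !scalerA.
  rewrite (_ : 4 * (2^-1 * 2^-1) = 1 :> R); last by field.
  by rewrite scale1r; ring.
rewrite -[jacobi_form k k]/(jacobi_scalar k0 k0 : _ -> _) linearZ /=.
rewrite jacobi_form_shift// mulrA -[X in X * _]/(4 / 2 ^+ 2).
by rewrite (_ : 4 / 2 ^+ 2 = 1 :> R) ?mul1r//; field.
Qed.

(** Even moments: X ^ (n + 2) = X ^ n - (1 - X ^ 2) X ^ n, and the factor
    1 - X ^ 2 raises k by 1. The same recurrence propagates the vanishing of the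
    odd moments from n = 1, where it is the symmetry between (1 + X) / 2 and
    (1 - X) / 2. *)
Lemma jacobi_form_monomial k n : 0 < k ->
  jacobi_form k k 'X^n = jacobi_mass k k * beta_moment k n.
Proof.
elim/ltn_ind: n k => -[|[|n]] IH k k0.
- by rewrite expr0 jacobi_form1// /beta_moment /= !poch0 divr1 mulr1.
- have -> : 'X^1 = half1pX ^+ 1 * half1mX ^+ 0 - half1pX ^+ 0 * half1mX ^+ 1 :> {poly R}.
    rewrite !expr1 !expr0 mulr1 mul1r /half1pX /half1mX -scalerBr.
    rewrite (_ : 1 + 'X - (1 - 'X) = 2 *: 'X :> {poly R}).
      by rewrite scalerA mulVf ?scale1r// pnatr_eq0.
    by rewrite scaler_nat; ring.
  rewrite -[jacobi_form k k]/(jacobi_scalar k0 k0 : _ -> _) linearB /=.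
  rewrite !jacobi_form_half1pX_half1mX// /beta_moment /= mulr0.
  by rewrite !poch0 !mulr1 add0n addn0 subrr.
have -> : 'X^(n.+2) = 'X^n - (1 - 'X^2) * 'X^n :> {poly R}.
  by rewrite (exprD _ 2 n); ring.
rewrite -[jacobi_form k k in LHS]/(jacobi_scalar k0 k0 : _ -> _) linearB /=.
have k1 : 0 < k + 1 by rewrite addr_gt0.
rewrite jacobi_form_1subX2// !IH// /beta_moment /= negbK.
case: ifP => [_|on]; first by rewrite !mulr0 subrr.
have -> : jacobi_mass (k + 1) (k + 1) = k / (k + 2^-1) * jacobi_mass k k.
  rewrite (@jacobi_massD R k k 1 1)// !pochSr !poch0 !addr0 !mul1r.
  by rewrite expr2; field; lra.
have p1 : poch (k + 2^-1) n./2.+1 = (k + 2^-1) * poch (k + 1 + 2^-1) n./2.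
  by rewrite pochS; congr (_ * poch _ _); ring.
have p2 := pochSr (k + 2^-1) n./2.
have p0 : poch (k + 2^-1) n./2 != 0 by rewrite poch_neq0//; lra.
have -> : poch (k + 1 + 2^-1) n./2 =
    poch (k + 2^-1) n./2 * (k + 2^-1 + n./2%:R) / (k + 2^-1).
  by rewrite -p2 p1; field; lra.
rewrite p2 pochSr; field; rewrite p0 /=.
by have := ler0n R n./2; lra.
Qed.

End symmetric_beta_moments.

(** * Double moments against two symmetric Beta measures *)

Lemma sum_even_terms (V : nmodType) (f : nat -> V) n :
  (forall i, odd i -> f i = 0) ->
  \sum_(i < (2 * n).+1) f i = \sum_(i < n.+1) f (2 * i)%N.
Proof.
move=> f0; elim: n => [|n IH]; first by rewrite !big_ord1.
rewrite mulnS add2n 2![in LHS]big_ord_recr /= IH f0 ?addr0.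
  by rewrite [RHS]big_ord_recr /= mulnS.
by rewrite /= oddM.
Qed.

Section product_moments.
Context {R : realType}.
Implicit Types (k u v c s x y : R) (q : {poly R}).

Definition beta_expect k q : R := jacobi_form k k q / jacobi_mass k k.

Lemma beta_expect_linear k : 0 < k -> scalar (beta_expect k).
Proof.
move=> k0 a f g; rewrite /beta_expect jacobi_form_linear// /=.
by rewrite mulrDl mulrA.
Qed.

Lemma beta_expectE k I (r : seq I) (a : I -> R) (n : I -> nat) : 0 < k ->
  beta_expect k (\sum_(i <- r) a i *: 'X^(n i)) =
  \sum_(i <- r) a i * beta_moment k (n i).
Proof.
move=> k0; pose L : {scalar {poly R}} := HB.pack (beta_expect k)
  (GRing.isLinear.Build R {poly R} R _ (beta_expect k) (beta_expect_linear k0)).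
rewrite -[beta_expect k]/(L : _ -> _) linear_sum /=.
apply: eq_bigr => i _.
rewrite -[beta_expect k]/(L : _ -> _) linearZ /=; congr (_ * _).
rewrite /beta_expect jacobi_form_monomial// mulrC mulKf//.
by rewrite gt_eqF ?jacobi_mass_gt0.
Qed.

(** The double moment of ((1 + u c + v s) / 2) ^ m, expanded by the binomial
    formula twice; that it is this integral is [integral_bilinear_power]. *)
Definition bilinear_moment k0 k1 c s m : R :=
  \sum_(e < m.+1) 'C(m, e)%:R * (\sum_(r < e.+1) 'C(e, r)%:R *
     (c ^+ r * beta_moment k0 r) * (s ^+ (e - r) * beta_moment k1 (e - r)))
  / 2 ^+ m.

Lemma expand_bilinear c s u v m :
  ((1 + u * c + v * s) / 2) ^+ m =
  \sum_(e < m.+1) \sum_(r < e.+1)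
    ('C(m, e)%:R * 'C(e, r)%:R / 2 ^+ m * c ^+ r * s ^+ (e - r)) *
    u ^+ r * v ^+ (e - r).
Proof.
rewrite expr_div_n -addrA exprDn mulr_suml; apply: eq_bigr => e _.
rewrite expr1n mul1r addrC exprDn -mulr_natr !mulr_suml.
apply: eq_bigr => r _; rewrite -mulr_natr !exprMn; ring.
Qed.

(** A flat index set, so that linearity applies to the double sums at once. *)
Lemma pair_sum_poly m :
  exists (t : seq (nat * nat)), forall (V : nmodType) (F : nat -> nat -> V),
  \sum_(e < m.+1) \sum_(r < e.+1) F e r = \sum_(i <- t) F i.1 i.2.
Proof.
exists [seq (e, r) | e <- iota 0 m.+1, r <- iota 0 e.+1] => V F.
rewrite big_allpairs_dep -[iota 0 m.+1]/(index_iota 0 m.+1) big_mkord.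
by apply: eq_bigr => e _; rewrite -[iota 0 e.+1]/(index_iota 0 e.+1) big_mkord.
Qed.

Lemma bilinear_moment0 k0 k1 c s : bilinear_moment k0 k1 c s 0 = 1.
Proof.
rewrite /bilinear_moment !big_ord1 /= /beta_moment /= !poch0 !expr0 !divr1.
by rewrite ?bin0 !mulr1.
Qed.

Lemma bilinear_bounds c s u v : `|c| + `|s| <= 1 ->
  u \in `[(-1)%R, 1%R] -> v \in `[(-1)%R, 1%R] ->
  0 <= (1 + u * c + v * s) / 2 <= 1.
Proof.
move=> cs; rewrite !in_itv/= -!ler_norml => u1 v1.
have uc : `|u * c| <= `|c| by rewrite normrM ler_piMl.
have vs : `|v * s| <= `|s| by rewrite normrM ler_piMl.
have := ler_norm (- (u * c)); have := ler_norm (- (v * s)).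
have := ler_norm (u * c); have := ler_norm (v * s).
rewrite !normrN; lra.
Qed.

(** The inner integral is a polynomial Q in u, which makes the outer integral
    measurable and computable. The values lie in [0, 1] since the integrand does
    and the measures are probabilities. *)
Lemma integral_bilinear_power k0 k1 c s m : 0 < k0 -> 0 < k1 ->
  `|c| + `|s| <= 1 ->
  exists Q : {poly R},
  [/\ forall u, u \in `[(-1)%R, 1%R] ->
        (\int[sym_beta (k1 - 2^-1)]_(v in `[(-1)%R, 1%R])
          (((1 + u * c + v * s) / 2) ^+ m)%:E = (Q.[u])%:E)%E,
      forall u, u \in `[(-1)%R, 1%R] -> 0 <= Q.[u] <= 1,
      (\int[sym_beta (k0 - 2^-1)]_(u in `[(-1)%R, 1%R]) (Q.[u])%:E =
        (bilinear_moment k0 k1 c s m)%:E)%E &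
      0 <= bilinear_moment k0 k1 c s m <= 1].
Proof.
move=> k0_gt0 k1_gt0 cs.
have pos u v : u \in `[(-1)%R, 1%R] -> v \in `[(-1)%R, 1%R] ->
    0 <= ((1 + u * c + v * s) / 2) ^+ m <= 1.
  move=> u1 v1; have /andP[w0 w1] := bilinear_bounds cs u1 v1.
  by rewrite exprn_ge0//= exprn_ile1.
have mean_le1 k (q : {poly R}) (E : \bar R) :
    (\int[sym_beta (k - 2^-1)]_(u in `[(-1)%R, 1%R]) (q.[u])%:E = E)%E ->
    (forall u, u \in `[(-1)%R, 1%R] -> 0 <= q.[u] <= 1) -> (0 <= E <= 1)%E.
  move=> <- q01; apply/andP; split.
    by apply: integral_ge0 => u u1; rewrite lee_fin; have /andP[] := q01 _ u1.
  apply: (@le_trans _ _ (\int[sym_beta (k - 2^-1)]_(u in `[(-1)%R, 1%R]) 1)%E).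
    apply: ge0_le_integral => //.
    - by move=> u u1; rewrite lee_fin; have /andP[] := q01 _ u1.
    - by apply/measurable_EFinP; apply: measurable_funTS; exact: measurable_poly.
    - by move=> u u1; rewrite lee_fin; have /andP[] := q01 _ u1.
  by rewrite integral_cst//= mul1e probability_le1.
have [t tE] := @pair_sum_poly m.
pose A e r := 'C(m, e)%:R * 'C(e, r)%:R / 2 ^+ m * c ^+ r * s ^+ (e - r).
pose q u : {poly R} := \sum_(i <- t) (A i.1 i.2 * u ^+ i.2) *: 'X^(i.1 - i.2).
have qE u v : (q u).[v] = ((1 + u * c + v * s) / 2) ^+ m.
  rewrite expand_bilinear (tE _ (fun e r => A e r * u ^+ r * v ^+ (e - r))).
  rewrite horner_sum; apply: eq_bigr => i _.
  by rewrite hornerZ hornerXn.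
pose Q : {poly R} :=
  \sum_(i <- t) (A i.1 i.2 * beta_moment k1 (i.1 - i.2)) *: 'X^(i.2).
have inner u : u \in `[(-1)%R, 1%R] ->
    (\int[sym_beta (k1 - 2^-1)]_(v in `[(-1)%R, 1%R])
       (((1 + u * c + v * s) / 2) ^+ m)%:E = (Q.[u])%:E)%E.
  move=> u1; under eq_integral do rewrite -qE.
  rewrite integral_sym_beta//; last first.
    by move=> v v1; rewrite qE; have /andP[] := pos u v u1 v1.
  rewrite -/(beta_expect k1 (q u)) beta_expectE// horner_sum; congr EFin.
  apply: eq_bigr => i _; rewrite hornerZ hornerXn; ring.
have Q01 u : u \in `[(-1)%R, 1%R] -> 0 <= Q.[u] <= 1.
  move=> u1; rewrite -!lee_fin; apply: (mean_le1 k1 (q u)).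
    by rewrite -inner//; apply: eq_integral => v _; rewrite qE.
  by move=> v v1; rewrite qE pos.
have outer : (\int[sym_beta (k0 - 2^-1)]_(u in `[(-1)%R, 1%R]) (Q.[u])%:E =
    (bilinear_moment k0 k1 c s m)%:E)%E.
  rewrite integral_sym_beta//; last by move=> u /Q01/andP[].
  rewrite -/(beta_expect k0 Q) beta_expectE//; congr EFin.
  rewrite -(tE _ (fun e r => A e r * beta_moment k1 (e - r) * beta_moment k0 r)).
  rewrite /bilinear_moment; apply: eq_bigr => e _.
  rewrite mulr_sumr mulr_suml; apply: eq_bigr => r _; rewrite /A; ring.
exists Q; split=> //; rewrite -!lee_fin; exact: mean_le1 outer Q01.
Qed.

End product_moments.

(** * The product formula, coefficient by coefficient *)

Section addition_formula.
Context {R : realType}.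
Implicit Types (k c s x y : R).

(** Half-integer rising factorials are quotients of factorials ([poch_half]). *)
Lemma beta_moment_pair k0 k1 i t : 0 < k0 -> 0 < k1 -> (t <= i)%N ->
  'C(2 * i, 2 * t)%:R * beta_moment k0 (2 * t) * beta_moment k1 (2 * i - 2 * t) =
  poch 2^-1 i *
   ('C(i, t)%:R / (poch (k0 + 2^-1) t * poch (k1 + 2^-1) (i - t))) :> R.
Proof.
move=> k00 k10 ti; rewrite -mulnBr /beta_moment !mul2n !odd_double !doubleK.
have p0 : poch (k0 + 2^-1) t != 0 by rewrite poch_neq0//; lra.
have p1 : poch (k1 + 2^-1) (i - t) != 0 by rewrite poch_neq0//; lra.
have fneq0 n : n`!%:R != 0 :> R by rewrite pnatr_eq0 -lt0n fact_gt0.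
have hf n : poch 2^-1 n = (2 * n)`!%:R / (4 ^+ n * n`!%:R) :> R.
  rewrite -poch_half mulfK// mulf_neq0 ?fneq0 ?expf_neq0 ?pnatr_eq0//.
have b1 := congr1 (fun n => n%:R : R) (bin_fact ti).
have t2 : (t.*2 <= i.*2)%N by rewrite leq_double.
have b2 := congr1 (fun n => n%:R : R) (bin_fact t2).
move: b1 b2; rewrite /= -doubleB !natrM => b1 b2.
have e4 : 4 ^+ i = 4 ^+ t * 4 ^+ (i - t) :> R by rewrite -exprD subnKC.
rewrite !hf !mul2n -b1 -b2 e4.
by field; rewrite p0 p1 !fneq0 !expf_neq0 ?pnatr_eq0 -?lt0n ?bin_gt0 ?ti.
Qed.

(** Odd powers integrate to 0; what remains of the power 2 i is K_i. *)
Lemma bilinear_moment_kernel k0 k1 c s x y m : 0 < k0 -> 0 < k1 ->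
  c ^+ 2 = (1 + x) / 2 * ((1 + y) / 2) ->
  s ^+ 2 = (1 - x) / 2 * ((1 - y) / 2) ->
  bilinear_moment k0 k1 c s m =
  (\sum_(i < m.+1) 'C(m, 2 * i)%:R *
     (even_kernel (k0 + 2^-1) (k1 + 2^-1) i x).[y]) / 2 ^+ m.
Proof.
move=> k00 k10 cE sE; rewrite /bilinear_moment -mulr_suml; congr (_ / _).
pose F e r := 'C(e, r)%:R * (c ^+ r * beta_moment k0 r) *
  (s ^+ (e - r) * beta_moment k1 (e - r)).
have F0 e r : odd r -> F e r = 0 by rewrite /F /beta_moment => ->; rewrite !mulr0 mul0r.
pose f e := 'C(m, e)%:R * \sum_(r < e.+1) F e r.
have f0 e : odd e -> f e = 0.
  move=> oe; rewrite /f big1 ?mulr0// => r _.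
  have [or|er] := boolP (odd r); first exact: F0.
  rewrite /F {2}/beta_moment oddB; last by rewrite -ltnS.
  by rewrite oe (negbTE er) /= !mulr0.
(* The terms with m < e vanish; the longer range is the one that pairs up. *)
transitivity (\sum_(e < (2 * m).+1) f e).
  rewrite -[RHS](big_mkord xpredT f) [RHS](@big_cat_nat _ _ _ m.+1)//=; last first.
    by rewrite ltnS leq_pmull.
  rewrite [X in _ = _ + X]big_nat_cond [X in _ = _ + X]big1 ?addr0.
    by rewrite big_mkord.
  by move=> e /andP[/andP[me _] _]; rewrite /f bin_small ?mul0r.
rewrite sum_even_terms//; apply: eq_bigr => i _; rewrite /f; congr (_ * _).
rewrite (sum_even_terms _ (F0 _)) even_kernelE mulr_sumr.
apply: eq_bigr => t _; have ti : (t <= i)%N by rewrite -ltnS.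
have bm := beta_moment_pair k00 k10 ti.
rewrite -cE -sE -!exprM /F.
transitivity (('C(2 * i, 2 * t)%:R * beta_moment k0 (2 * t) *
  beta_moment k1 (2 * i - 2 * t)) * c ^+ (2 * t) * s ^+ (2 * i - 2 * t)).
  by ring.
by rewrite bm mulnBr; ring.
Qed.

Lemma orthonormal_jacobi_form k0 k1 (p : nat -> {poly R}) : 0 < k0 -> 0 < k1 ->
  orthonormal_jacobi (k1 - 2^-1) (k0 - 2^-1) p ->
  (forall j, size (p j) = j.+1) /\
  (forall i j, jacobi_form (k0 + 2^-1) (k1 + 2^-1) (p i * p j) = (i == j)%:R).
Proof.
move=> k00 k10 [sp op]; split=> // i j; apply: EFin_inj.
rewrite -integral_jacobi_itv; [|lra|lra].
rewrite -op; apply: eq_integral => s _; rewrite hornerM.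
by congr (_ * (_ `^ _ * _ `^ _))%:E; field.
Qed.

(** The coefficient of (z / 2) ^ (2 m + 2 N) in I_(4 j + 2 N) (z). *)
Definition bessel_coef (N : R) m j : R :=
  if (2 * j <= m)%N then
    ((m - 2 * j)`!%:R * Gamma ((m - 2 * j)%:R + ((4 * j)%:R + 2 * N) + 1))^-1
  else 0.

Lemma bessel_coef_ge0 N m j : 0 < N -> 0 <= bessel_coef N m j.
Proof.
move=> N0; rewrite /bessel_coef; case: ifP => // _.
rewrite invr_ge0 mulr_ge0// ltW// Gamma_gt0//.
by rewrite ltr_wpDl// addr_ge0// addr_ge0// mulr_ge0// ltW.
Qed.

Lemma c2E k0 k1 : 0 < k0 -> 0 < k1 ->
  c2 k0 k1 = jacobi_mass (k0 + 2^-1) (k1 + 2^-1) * Gamma (2 * (k0 + k1) + 1).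
Proof.
move=> k00 k10; rewrite /c2 /jacobi_mass.
have -> : k0 + 2^-1 + (k1 + 2^-1) = k0 + k1 + 1 by field.
rewrite addrK; move: (Gamma _) (Gamma _) (Gamma _) (Gamma _) (_ `^ _) => *.
by ring.
Qed.

(** The identity of the coefficients of (z / 2) ^ (2 m) on the two sides: expand
    the kernels of [bilinear_moment_kernel] in Jacobi polynomials, exchange the
    two finite sums and evaluate the sum over i by [binomial_poch_sum]. *)
Lemma addition_formula k0 k1 (p : nat -> {poly R}) c s x y m :
  0 < k0 -> 0 < k1 ->
  orthonormal_jacobi (k1 - 2^-1) (k0 - 2^-1) p ->
  c ^+ 2 = (1 + x) / 2 * ((1 + y) / 2) ->
  s ^+ 2 = (1 - x) / 2 * ((1 - y) / 2) ->
  c2 k0 k1 *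
    (\sum_(j < m.+1) bessel_coef (k0 + k1) m j * ((p j).[x] * (p j).[y])) =
  Gamma (k0 + k1 + 2^-1) * bilinear_moment k0 k1 c s m /
    (Gamma (m%:R + (k0 + k1) + 2^-1) * m`!%:R).
Proof.
move=> k00 k10 /(orthonormal_jacobi_form k00 k10)[sp op] cE sE.
set N := k0 + k1; have N0 : 0 < N by rewrite addr_gt0.
have a0 : 0 < k0 + 2^-1 by lra.
have a1 : 0 < k1 + 2^-1 by lra.
set W := jacobi_mass (k0 + 2^-1) (k1 + 2^-1).
have fneq0 n : n`!%:R != 0 :> R by rewrite pnatr_eq0 -lt0n fact_gt0.
have Gneq0 z : 0 < z -> Gamma z != 0 :> R by move=> z0; rewrite gt_eqF ?Gamma_gt0.
have p0 : poch (N + 2^-1) m != 0 by rewrite poch_neq0//; lra.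
have -> : Gamma (m%:R + N + 2^-1) = poch (N + 2^-1) m * Gamma (N + 2^-1).
  rewrite -Gamma_poch; last by lra.
  by congr Gamma; ring.
transitivity (bilinear_moment k0 k1 c s m / (poch (N + 2^-1) m * m`!%:R)); last first.
  have := Gneq0 (N + 2^-1) ltac:(lra); move: (Gamma _) (bilinear_moment _ _ _ _ _).
  by move=> G b G0; field; rewrite G0 p0 fneq0.
have formE i j : jacobi_scalar a0 a1 (half1pX ^+ i * half1mX ^+ j) = W *
    poch (k0 + 2^-1) i * poch (k1 + 2^-1) j /
    poch (k0 + 2^-1 + (k1 + 2^-1)) (i + j).
  exact: jacobi_form_half1pX_half1mX.
have KE i := @kernel_expand _ _ W _ _ p a0 a1 formE sp op i m.+1 x y.
rewrite (bilinear_moment_kernel _ _ _ cE sE)// c2E// -/W -/N.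
transitivity ((\sum_(j < m.+1) (\sum_(i < m.+1) 'C(m, 2 * i)%:R *
    kernel_eigen W (k0 + 2^-1) (k1 + 2^-1) i j) * ((p j).[x] * (p j).[y])) / 2 ^+ m /
   (poch (N + 2^-1) m * m`!%:R)); last first.
  congr (_ / _ / _); under eq_bigr do rewrite mulr_suml.
  rewrite exchange_big /=; apply: eq_bigr => i _.
  rewrite KE// mulr_sumr; by apply: eq_bigr => j _; rewrite -mulrA.
rewrite mulr_sumr !mulr_suml; apply: eq_bigr => j _.
have -> : \sum_(i < m.+1) 'C(m, 2 * i)%:R *
    kernel_eigen W (k0 + 2^-1) (k1 + 2^-1) i j =
    W * (if (2 * j <= m)%N then
     m`!%:R / (m - 2 * j)`!%:R * 2 ^+ m * poch (N + 2^-1) m /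
     poch (2 * N + 1) (m + 2 * j) else 0).
  rewrite -binomial_poch_sum// mulr_sumr; apply: eq_bigr => i _.
  rewrite /kernel_eigen (_ : k0 + 2^-1 + (k1 + 2^-1) = N + 1); last first.
    by rewrite /N; field.
  by ring.
rewrite /bessel_coef; case: ifP => [jm|_]; last by rewrite !(mul0r, mulr0).
have -> : Gamma ((m - 2 * j)%:R + ((4 * j)%:R + 2 * N) + 1) =
    poch (2 * N + 1) (m + 2 * j) * Gamma (2 * N + 1).
  rewrite -Gamma_poch; last by lra.
  by congr Gamma; rewrite natrB// natrD !natrM; ring.
have G0 := Gneq0 (2 * N + 1) ltac:(lra).
have q0 : poch (2 * N + 1) (m + 2 * j) != 0 by rewrite poch_neq0//; lra.
have e0 : 2 ^+ m != 0 :> R by rewrite expf_neq0 ?pnatr_eq0.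
have := fneq0 m; have := fneq0 (m - 2 * j)%N.
move: p0 q0 e0 G0.
move: (Gamma _) (poch (2 * N + 1) _) (poch _ _) (2 ^+ _) (_`!%:R) (_`!%:R).
move: (_.[x]) (_.[y]) => X Y G q' p' E f1 f2 p0 q0 e0 G0 f10 f20.
by field; rewrite p0 q0 e0 G0 f10 f20.
Qed.

End addition_formula.

(** * Series with nonnegative terms and Bessel series *)

Section nonnegative_series.
Context {R : realType}.
Implicit Types (a b : R ^nat) (l : R).

Lemma series_EFin a l : (forall n, 0 <= a n) ->
  series a @ \oo --> l -> (\sum_(n <oo) (a n)%:E = l%:E)%E.
Proof.
move=> a0 al; apply/cvg_lim => //.
rewrite (_ : (fun n => _) = EFin \o series a); last first.
  by apply/funext => n; rewrite /series/= sumEFin.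
by apply: cvg_EFin; [exact: nearW|exact: al].
Qed.

Lemma EFin_series a l : (forall n, 0 <= a n) ->
  (\sum_(n <oo) (a n)%:E = l%:E)%E -> series a @ \oo --> l.
Proof.
move=> a0 al.
have cv : cvgn (series a).
  apply: nondecreasing_is_cvgn; first exact: nondecreasing_series.
  exists l => _ [n _ <-]; rewrite -lee_fin -al /series/= -sumEFin.
  by apply: nneseries_lim_ge => k _ _; rewrite lee_fin.
rewrite -(@EFin_inj _ (limn (series a)) l)//.
by rewrite -al; apply/esym; exact: series_EFin.
Qed.

Lemma nneseries_shift (F : (\bar R) ^nat) K : (forall n, 0 <= F n)%E ->
  (forall n, (n < K)%N -> F n = 0%E) ->
  (\sum_(n <oo) F n = \sum_(n <oo) F (n + K)%N)%E.
Proof.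
move=> F0 FK; apply/cvg_lim => //; rewrite -(cvg_shiftn K) /=.
rewrite (_ : (fun n => _) = (fun n => \sum_(0 <= i < n) F (i + K)%N)%E); last first.
  apply/funext => n; rewrite (@big_cat_nat _ _ _ K)//= ?leq_addl//.
  rewrite big_nat big1 => [|i /andP[_ /FK]//].
  by rewrite add0e -{1}[K]add0n big_addn addnK.
exact: is_cvg_nneseries.
Qed.

Lemma nneseries_finite (F : (\bar R) ^nat) K : (forall n, 0 <= F n)%E ->
  (forall n, (K <= n)%N -> F n = 0%E) ->
  (\sum_(n <oo) F n = \sum_(n < K) F n)%E.
Proof.
move=> F0 FK; rewrite (@nneseries_split _ F 0 K)// add0n.
by rewrite eseries0 ?adde0 ?big_mkord// => n Kn _; exact: FK.
Qed.

End nonnegative_series.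

Section bessel_series.
Context {R : realType}.
Implicit Types (nu h z N : R).

Definition bessel_term nu h m : R := h ^+ (2 * m) / (Gamma (m%:R + nu + 1) * m`!%:R).

Lemma bessel_term_ge0 nu h m : 0 <= nu -> 0 <= bessel_term nu h m.
Proof.
move=> nu0; apply: divr_ge0; first by rewrite exprM exprn_ge0 ?sqr_ge0.
by rewrite mulr_ge0// ltW// Gamma_gt0// ltr_wpDl// addr_ge0.
Qed.

(** Domination by the exponential series, as Gamma (m + nu + 1) is at least
    Gamma (nu + 1). *)
Lemma bessel_term_cvg nu h : 0 <= nu -> cvgn (series (bessel_term nu h)).
Proof.
move=> nu0; have G0 : 0 < Gamma (nu + 1) by rewrite Gamma_gt0// ltr_wpDl.
apply: (@series_le_cvg _ _ (fun m => (Gamma (nu + 1))^-1 * exp_coeff (h ^+ 2) m)).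
- by move=> m; exact: bessel_term_ge0.
- move=> m /=; rewrite mulr_ge0 ?invr_ge0 ?(ltW G0)//.
  by apply: divr_ge0 => //; rewrite exprn_ge0 ?sqr_ge0.
- move=> m /=; have nu1 : 0 < nu + 1 by rewrite ltr_wpDl.
  have GE : Gamma (m%:R + nu + 1) = poch (nu + 1) m * Gamma (nu + 1).
    by rewrite -(Gamma_poch m nu1); congr Gamma; ring.
  rewrite /bessel_term /exp_coeff /= exprM GE.
  move: (Gamma _) G0 => G G0.
  have p1 : 1 <= poch (nu + 1) m by rewrite poch_ge1// lerDr.
  have p0 : 0 < poch (nu + 1) m by rewrite (lt_le_trans ltr01).
  have f0 : 0 < m`!%:R :> R by rewrite ltr0n fact_gt0.
  have h2 : 0 <= (h ^+ 2) ^+ m by apply: exprn_ge0; exact: sqr_ge0.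
  rewrite -subr_ge0 (_ : _ - _ = G^-1 * ((h ^+ 2) ^+ m / m`!%:R) *
     (1 - (poch (nu + 1) m)^-1)).
    rewrite !mulr_ge0 ?invr_ge0 ?(ltW G0) ?(ltW f0) ?h2//.
    by rewrite subr_ge0 invf_le1.
  by field; rewrite !gt_eqF.
- by apply: is_cvg_seriesZ; exact: is_cvg_series_exp_coeff.
Qed.

Lemma bessel_iE nu z : bessel_i nu z = limn (series (bessel_term nu (z / 2))).
Proof. by []. Qed.

Lemma bessel_IE nu z : 0 < z -> 0 <= nu ->
  bessel_I nu z = (z / 2) `^ nu * bessel_i nu z.
Proof.
move=> z0 nu0; have h0 : 0 < z / 2 by rewrite divr_gt0.
rewrite /bessel_I; apply/cvg_lim => //.
rewrite (_ : series _ = (z / 2) `^ nu *: series (bessel_term nu (z / 2))).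
  apply: cvgZl_tmp; rewrite bessel_iE; exact: bessel_term_cvg.
rewrite -seriesZ; congr series; apply/funext => m /=.
rewrite /bessel_term powRD ?(gt_eqF h0) ?implybT//.
by rewrite powR_mulrn ?(ltW h0)// [m`!%:R * _]mulrC -mulrA mulrCA.
Qed.

End bessel_series.

(** * Rearrangement of the Bessel double series *)

Section rearrangement.
Context {R : realType}.
Variables (N z : R).
Hypothesis N0 : 0 < N.
Implicit Types g P Q : R ^nat.

Let h := z / 2.

(** [bessel_row] and [bessel_column] are the two kinds of partial sums of one
    double array, with entries h ^ (2 m) * [bessel_coef] N m j * g j: the former
    sums over j, finitely many terms, the latter over m
    ([bessel_column_series]). *)
Definition bessel_row g m : R :=
  h ^+ (2 * m) * \sum_(j < m.+1) bessel_coef N m j * g j.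

Definition bessel_column j : R := h ^+ (4 * j) * bessel_i ((4 * j)%:R + 2 * N) z.

Lemma bessel_column_series j g : (forall j, 0 <= g j) ->
  ((bessel_column j * g j)%:E =
   \sum_(m <oo) (h ^+ (2 * m) * (bessel_coef N m j * g j))%:E)%E.
Proof.
move=> g0; set nu := (4 * j)%:R + 2 * N.
have nu0 : 0 <= nu by rewrite addr_ge0// mulr_ge0// ltW.
have e0 n : 0 <= h ^+ (2 * n) by rewrite exprM; apply: exprn_ge0; exact: sqr_ge0.
rewrite (@nneseries_shift _ _ (2 * j)); first last.
- move=> n nj; rewrite /bessel_coef leqNgt nj/= mul0r mulr0//.
- move=> n; rewrite lee_fin !mulr_ge0//; exact: bessel_coef_ge0.
have j4 : (2 * (2 * j) = 4 * j)%N by rewrite mulnA.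
have h4 : 0 <= h ^+ (4 * j) by rewrite -j4 e0.
apply/esym; apply: (@series_EFin _
   (fun m => h ^+ (2 * (m + 2 * j)) * (bessel_coef N (m + 2 * j) j * g j))).
  by move=> m; rewrite !mulr_ge0//; exact: bessel_coef_ge0.
rewrite (_ : (fun m : nat => _) =
    (h ^+ (4 * j) * g j) *: bessel_term nu h); last first.
  apply/funext => m.
  rewrite -[RHS]/(h ^+ (4 * j) * g j * bessel_term nu h m) /=.
  rewrite /bessel_coef leq_addl addnK /bessel_term -/nu.
  rewrite mulnDr exprD j4.
  rewrite [m`!%:R * _]mulrC.
  move: (_^-1) (h ^+ (2 * m)) (h ^+ (4 * j)) (g j) => A B C D.
  by ring.
rewrite seriesZ /bessel_column mulrAC.
by apply: cvgZl_tmp; exact: bessel_term_cvg.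
Qed.

Lemma bessel_row_ge0 g m : (forall j, 0 <= g j) -> 0 <= bessel_row g m.
Proof.
move=> g0; rewrite mulr_ge0//.
  by rewrite exprM; apply: exprn_ge0; exact: sqr_ge0.
by apply: sumr_ge0 => j _; rewrite mulr_ge0// bessel_coef_ge0.
Qed.

Lemma bessel_column_ge0 j : 0 <= bessel_column j.
Proof.
rewrite -lee_fin -[bessel_column j]mulr1.
rewrite (bessel_column_series j (fun=> ler01)).
apply: nneseries_ge0 => n _ _; rewrite lee_fin mulr1 mulr_ge0 ?bessel_coef_ge0//.
by rewrite exprM; apply: exprn_ge0; exact: sqr_ge0.
Qed.

Lemma rearrange_ge0 g (l : R) : (forall j, 0 <= g j) ->
  series (bessel_row g) @ \oo --> l ->
  series (fun j => bessel_column j * g j) @ \oo --> l.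
Proof.
move=> g0 gl; apply: EFin_series.
  by move=> j; rewrite mulr_ge0// bessel_column_ge0.
rewrite -(@series_EFin _ (bessel_row g) l)//; last by move=> m; exact: bessel_row_ge0.
have F0 m j : (0 <= (h ^+ (2 * m) * (bessel_coef N m j * g j))%:E)%E.
  rewrite lee_fin !mulr_ge0 ?bessel_coef_ge0//.
  by rewrite exprM; apply: exprn_ge0; exact: sqr_ge0.
transitivity (\sum_(j <oo) \sum_(m <oo)
    (h ^+ (2 * m) * (bessel_coef N m j * g j))%:E)%E.
  by apply: eq_eseriesr => j _; exact: bessel_column_series.
rewrite nneseries_interchange//; apply: eq_eseriesr => m _.
rewrite (@nneseries_finite _ _ m.+1)//; last first.
  move=> j mj; rewrite /bessel_coef ifF ?mul0r ?mulr0//.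
  by apply/negbTE; rewrite -ltnNge (leq_trans mj)// leq_pmull.
by rewrite sumEFin /bessel_row mulr_sumr.
Qed.

Lemma bessel_row_linear a b P Q m :
  bessel_row (fun j => a * P j + b * Q j) m =
  a * bessel_row P m + b * bessel_row Q m.
Proof.
rewrite /bessel_row !mulr_sumr -big_split; apply: eq_bigr => j _ /=; ring.
Qed.

Lemma bessel_row_le P Q m : (forall j, P j <= Q j) ->
  bessel_row P m <= bessel_row Q m.
Proof.
move=> PQ; apply: ler_wpM2l.
  by rewrite exprM; apply: exprn_ge0; exact: sqr_ge0.
by apply: ler_sum => j _; rewrite ler_wpM2l// bessel_coef_ge0.
Qed.

(** Polarisation. The squares (P + Q) ^ 2 and (P - Q) ^ 2 are dominated by
    2 P ^ 2 + 2 Q ^ 2, so that [rearrange_ge0] applies to both. *)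
Lemma rearrange_product P Q (l : R) :
  cvgn (series (bessel_row (fun j => P j ^+ 2))) ->
  cvgn (series (bessel_row (fun j => Q j ^+ 2))) ->
  series (bessel_row (fun j => P j * Q j)) @ \oo --> l ->
  series (fun j => bessel_column j * (P j * Q j)) @ \oo --> l.
Proof.
move=> cP cQ cPQ.
have sq (e : R) : e ^+ 2 = 1 ->
    cvgn (series (bessel_row (fun j => (P j + e * Q j) ^+ 2))).
  move=> e2; apply: (@series_le_cvg _ _
    (fun m => 2 * bessel_row (fun j => P j ^+ 2) m + 2 * bessel_row (fun j => Q
      j ^+ 2) m)).
  - by move=> m; apply: bessel_row_ge0 => j; exact: sqr_ge0.
  - by move=> m; rewrite addr_ge0// mulr_ge0// bessel_row_ge0// => j; exact: sqr_ge0.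
  - move=> m; rewrite -bessel_row_linear; apply: bessel_row_le => j.
    have := sqr_ge0 (P j - e * Q j).
    rewrite sqrrB sqrrD !exprMn e2 mul1r; lra.
  - exact: is_cvg_seriesD (is_cvg_seriesZ (k := 2) cP) (is_cvg_seriesZ (k := 2) cQ).
have cplus := sq 1 (expr1n _ _).
have cminus := sq (-1) (ltac:(by rewrite sqrrN expr1n)).
have sq0 e j : 0 <= (P j + e * Q j) ^+ 2 by exact: sqr_ge0.
have rplus := rearrange_ge0 (sq0 1) cplus.
have rminus := rearrange_ge0 (sq0 (-1)) cminus.
set lp := limn _ in rplus; set lm := limn _ in rminus.
have diff (A B : R ^nat) :
    series A @ \oo --> lp -> series B @ \oo --> lm ->
    series (4^-1 *: (A - B)) @ \oo --> 4^-1 *: (lp - lm).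
  move=> Al Bl; rewrite seriesZ seriesD seriesN; apply: cvgZl_tmp; exact: cvgB.
have -> : l = 4^-1 *: (lp - lm).
  apply: (cvg_unique _ cPQ) => //; have := diff _ _ cplus cminus.
  rewrite (_ : 4^-1 *: _ = bessel_row (fun j => P j * Q j))//.
  apply/funext => m; rewrite -[LHS]/(4^-1 * (_ - _)).
  rewrite -[_ - _]/(bessel_row (fun j => (P j + 1 * Q j) ^+ 2) m -
     bessel_row (fun j => (P j + -1 * Q j) ^+ 2) m).
  transitivity (bessel_row (fun j => 4^-1 * (P j + 1 * Q j) ^+ 2 +
     (- 4^-1) * (P j + -1 * Q j) ^+ 2) m); first by rewrite bessel_row_linear; ring.
  by congr bessel_row; apply/funext => j; field.
have := diff _ _ rplus rminus.
rewrite (_ : 4^-1 *: _ = (fun j => bessel_column j * (P j * Q j)))//.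
apply/funext => j; rewrite -[LHS]/(4^-1 * (bessel_column j * (P j + 1 * Q j) ^+ 2
  - bessel_column j * (P j + -1 * Q j) ^+ 2)).
by field.
Qed.

End rearrangement.

(** * The integral side and the conclusion *)

Section bessel_integral.
Context {R : realType}.
Implicit Types (k c s z nu : R).

Lemma cvg_bilinear_bessel nu k0 k1 c s z : 0 <= nu -> 0 < k0 -> 0 < k1 ->
  `|c| + `|s| <= 1 ->
  cvgn (series (fun m => bessel_term nu (z / 2) m * bilinear_moment k0 k1 c s m)).
Proof.
move=> nu0 k00 k10 cs; apply: (@series_le_cvg _ _ (bessel_term nu (z / 2))).
- move=> m /=; have [Q [_ _ _ /andP[b0 _]]] := integral_bilinear_power m k00 k10 cs.
  by rewrite mulr_ge0// bessel_term_ge0.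
- by move=> m; exact: bessel_term_ge0.
- move=> m /=; have [Q [_ _ _ /andP[_ b1]]] := integral_bilinear_power m k00 k10 cs.
  by rewrite ler_piMr// bessel_term_ge0.
- exact: bessel_term_cvg.
Qed.

(** Monotone convergence twice: the Bessel series has nonnegative terms, and
    the square root disappears as only even powers occur. *)
Lemma integral_bilinear_bessel nu k0 k1 c s z : 0 <= nu -> 0 < k0 -> 0 < k1 ->
  `|c| + `|s| <= 1 ->
  (\int[sym_beta (k0 - 2^-1)]_(u in `[(-1)%R, 1%R])
     \int[sym_beta (k1 - 2^-1)]_(v in `[(-1)%R, 1%R])
       (bessel_i nu (z * Num.sqrt ((1 + u * c + v * s) / 2)))%:E =
   (limn (series (fun m =>
      bessel_term nu (z / 2) m * bilinear_moment k0 k1 c s m)))%:E)%E.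
Proof.
move=> nu0 k00 k10 cs.
pose ka := bessel_term nu (z / 2); pose b u v := (1 + u * c + v * s) / 2.
have ka0 m : 0 <= ka m by exact: bessel_term_ge0.
have b01 u v : u \in `[(-1)%R, 1%R] -> v \in `[(-1)%R, 1%R] -> 0 <= b u v.
  by move=> u1 v1; have /andP[] := bilinear_bounds cs u1 v1.
have mb u : measurable_fun [set: R] (b u).
  by apply: measurable_funM => //; apply: measurable_funD => //; exact: measurable_funM.
have termE u v : u \in `[(-1)%R, 1%R] -> v \in `[(-1)%R, 1%R] ->
   ((bessel_i nu (z * Num.sqrt (b u v)))%:E =
    \sum_(m <oo) (ka m * b u v ^+ m)%:E)%E.
  move=> u1 v1; rewrite bessel_iE.
  have -> : bessel_term nu (z * Num.sqrt (b u v) / 2) = (fun m => ka m * b u v ^+ m).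
    apply/funext => m; rewrite /ka /bessel_term mulrAC exprMn.
    rewrite [Num.sqrt _ ^+ _]exprM sqr_sqrtr ?b01//; ring.
  apply/esym/series_EFin => [m|]; first by rewrite mulr_ge0// exprn_ge0// b01.
  apply: (@series_le_cvg _ _ (bessel_term nu (z / 2))).
  - by move=> m /=; rewrite mulr_ge0// exprn_ge0// b01.
  - exact: ka0.
  - move=> m /=; rewrite ler_piMr// exprn_ile1//.
      exact: b01.
    by have /andP[] := bilinear_bounds cs u1 v1.
  - exact: bessel_term_cvg.
have inner m : exists Q : {poly R},
   [/\ (forall u, u \in `[(-1)%R, 1%R] ->
        \int[sym_beta (k1 - 2^-1)]_(v in `[(-1)%R, 1%R])
          (ka m * b u v ^+ m)%:E = (ka m * Q.[u])%:E)%E,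
      (forall u, u \in `[(-1)%R, 1%R] -> 0 <= Q.[u]) &
      (\int[sym_beta (k0 - 2^-1)]_(u in `[(-1)%R, 1%R]) (ka m * Q.[u])%:E =
        (ka m * bilinear_moment k0 k1 c s m)%:E)%E].
  have [Q [Q1 Q2 Q3 _]] := integral_bilinear_power m k00 k10 cs.
  have Q0 u : u \in `[(-1)%R, 1%R] -> 0 <= Q.[u] by move=> /Q2/andP[].
  exists Q; split=> //.
    move=> u u1; under eq_integral do rewrite EFinM.
    rewrite ge0_integralZl_EFin; [by rewrite Q1| exact: measurable_itv| | |exact: ka0].
      by move=> v v1; rewrite lee_fin exprn_ge0// b01.
    apply/measurable_EFinP; apply: measurable_funTS; apply: measurable_funX.
    exact: mb.
  under eq_integral do rewrite EFinM.
  rewrite ge0_integralZl_EFin; [by rewrite Q3| exact: measurable_itv| | |exact: ka0].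
    by move=> u u1; rewrite lee_fin Q0.
  by apply/measurable_EFinP; apply: measurable_funTS; exact: measurable_poly.
have [Q /all_and3[Q1 Q2 Q3]] := choice inner.
transitivity (\int[sym_beta (k0 - 2^-1)]_(u in `[(-1)%R, 1%R])
    \sum_(m <oo) (ka m * (Q m).[u])%:E)%E.
  apply: eq_integral => u /set_mem u1.
  transitivity (\int[sym_beta (k1 - 2^-1)]_(v in `[(-1)%R, 1%R])
      \sum_(m <oo) (ka m * b u v ^+ m)%:E)%E.
    by apply: eq_integral => v /set_mem v1; exact: termE.
  rewrite integral_nneseries; [|exact: measurable_itv| |].
  - by apply: eq_eseriesr => m _; exact: Q1.
  - move=> m; apply/measurable_EFinP; apply: measurable_funTS.
    apply: measurable_funM => //; apply: measurable_funX; exact: mb.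
  - by move=> m v v1; rewrite lee_fin mulr_ge0// exprn_ge0// b01.
rewrite integral_nneseries; [|exact: measurable_itv| |].
- under eq_eseriesr do rewrite Q3.
  apply: series_EFin; last exact: cvg_bilinear_bessel.
  move=> m; have [_ [_ _ _ /andP[b0 _]]] := integral_bilinear_power m k00 k10 cs.
  by rewrite mulr_ge0.
- move=> m; apply/measurable_EFinP; apply: measurable_funTS.
  by apply: measurable_funM => //; exact: measurable_poly.
- by move=> m u u1; rewrite lee_fin mulr_ge0// Q2.
Qed.

(** The first term of the series, all others being nonnegative. *)
Lemma bilinear_bessel_ge nu k0 k1 c s z : 0 <= nu -> 0 < k0 -> 0 < k1 ->
  `|c| + `|s| <= 1 ->
  (Gamma (nu + 1))^-1 <= limn (series (fun m =>
      bessel_term nu (z / 2) m * bilinear_moment k0 k1 c s m)).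
Proof.
move=> nu0 k00 k10 cs; have cv := cvg_bilinear_bessel (z := z) nu0 k00 k10 cs.
have -> : (Gamma (nu + 1))^-1 = series (fun m =>
      bessel_term nu (z / 2) m * bilinear_moment k0 k1 c s m) 1%N.
  rewrite /series/= big_nat1 bilinear_moment0 mulr1 /bessel_term.
  by rewrite muln0 expr0 add0r fact0 mulr1 mul1r.
apply: nondecreasing_cvgn_le => //; apply: nondecreasing_series => m _ _.
have [_ [_ _ _ /andP[b0 _]]] := integral_bilinear_power m k00 k10 cs.
by rewrite mulr_ge0// bessel_term_ge0.
Qed.

End bessel_integral.

Lemma cos_sin_products_le1 (R : realType) (a b : R) :
  `|cos b * cos a| + `|sin b * sin a| <= 1.
Proof.
have h1 := cos_le1 (a - b); have h2 := cos_le1 (a + b).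
have h3 := cos_geN1 (a - b); have h4 := cos_geN1 (a + b).
move: h1 h2 h3 h4; rewrite cosB cosD.
rewrite [cos a * _]mulrC [sin a * _]mulrC.
move: (cos b * cos a) (sin b * sin a) => x y *.
have [x0|x0] := leP 0 x; have [y0|y0] := leP 0 y;
  rewrite ?(ger0_norm x0) ?(ger0_norm y0) ?(ltr0_norm x0) ?(ltr0_norm y0); lra.
Qed.

Section half_angles.
Context {R : realType}.
Implicit Types a : R.

Lemma cos_sqr_half a : cos a ^+ 2 = (1 + cos (2 * a)) / 2.
Proof. by rewrite mulr_natl cos_mulr2n mulr2n; field. Qed.

Lemma sin_sqr_half a : sin a ^+ 2 = (1 - cos (2 * a)) / 2.
Proof. by rewrite mulr_natl cos_mulr2n sin2cos2 mulr2n; field. Qed.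

End half_angles.

Lemma bilinear_bessel0 (R : realType) (nu k0 k1 c s : R) :
  series (fun m => bessel_term nu 0 m * bilinear_moment k0 k1 c s m) @ \oo -->
  (Gamma (nu + 1))^-1.
Proof.
rewrite -cvg_shiftS /=.
rewrite (_ : (fun n => _) = fun=> (Gamma (nu + 1))^-1); first exact: cvg_cst.
apply/funext => n; rewrite /series/= big_nat_recl//= big1 ?addr0.
  by rewrite /bessel_term bilinear_moment0 muln0 expr0 add0r fact0 !mulr1 mul1r.
by move=> i _; rewrite /bessel_term mulnS expr0n mul0r mul0r.
Qed.

Lemma c2_gt0 (R : realType) (k0 k1 : R) : 0 < k0 -> 0 < k1 -> 0 < c2 k0 k1.
Proof.
move=> k00 k10; rewrite c2E// mulr_gt0//.
  by apply: jacobi_mass_gt0; lra.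
by apply: Gamma_gt0; lra.
Qed.

Lemma bessel_row_jacobi (R : realType) (k0 k1 : R) (p : nat -> {poly R})
    (z a b : R) m : 0 < k0 -> 0 < k1 ->
  orthonormal_jacobi (k1 - 2^-1) (k0 - 2^-1) p ->
  let N := k0 + k1 in
  bessel_row N z (fun j => (p j).[cos (2 * a)] * (p j).[cos (2 * b)]) m =
  Gamma (N + 2^-1) / c2 k0 k1 *
    (bessel_term (N - 2^-1) (z / 2) m *
     bilinear_moment k0 k1 (cos b * cos a) (sin b * sin a) m).
Proof.
move=> k00 k10 op N.
have := @addition_formula R k0 k1 p (cos b * cos a) (sin b * sin a)
  (cos (2 * a)) (cos (2 * b)) m k00 k10 op.
rewrite !exprMn !cos_sqr_half !sin_sqr_half => /(_ (mulrC _ _) (mulrC _ _)).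
rewrite -/N /bessel_row /bessel_term.
have -> : m%:R + (N - 2^-1) + 1 = m%:R + N + 2^-1 by field.
have := c2_gt0 k00 k10; move: (\sum_(j < m.+1) _) (c2 _ _) => T C C0 CT.
have -> : T = C^-1 * (C * T) by rewrite mulKf ?gt_eqF.
rewrite CT.
move: (Gamma (m%:R + N + 2^-1) * _) (Gamma _) (bilinear_moment _ _ _ _ _) => *.
by ring.
Qed.

(** The rows for x = y converge by the product formula, the double moments being
    at most 1; this is the domination that [rearrange_product] asks for. *)
Lemma jacobi_bessel_series (R : realType) (k0 k1 : R) (p : nat -> {poly R})
    (z a b : R) : 0 < k0 -> 0 < k1 -> 2^-1 <= k0 + k1 ->
  orthonormal_jacobi (k1 - 2^-1) (k0 - 2^-1) p ->
  let N := k0 + k1 in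
  series (fun j => bessel_column N z j *
     ((p j).[cos (2 * a)] * (p j).[cos (2 * b)])) @ \oo -->
  Gamma (N + 2^-1) / c2 k0 k1 * limn (series (fun m =>
    bessel_term (N - 2^-1) (z / 2) m *
    bilinear_moment k0 k1 (cos b * cos a) (sin b * sin a) m)).
Proof.
move=> k00 k10 N1 op N; have N0 : 0 < N by rewrite addr_gt0.
have nu0 : 0 <= N - 2^-1 by rewrite subr_ge0.
have row x y : series (bessel_row N z
     (fun j => (p j).[cos (2 * x)] * (p j).[cos (2 * y)]))
   @ \oo --> Gamma (N + 2^-1) / c2 k0 k1 * limn (series (fun m =>
    bessel_term (N - 2^-1) (z / 2) m *
    bilinear_moment k0 k1 (cos y * cos x) (sin y * sin x) m)).
  rewrite (_ : bessel_row _ _ _ = (Gamma (N + 2^-1) / c2 k0 k1) *: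
      (fun m => bessel_term (N - 2^-1) (z / 2) m *
       bilinear_moment k0 k1 (cos y * cos x) (sin y * sin x) m)); last first.
    by apply/funext => m; exact: bessel_row_jacobi.
  rewrite seriesZ; apply: cvgZl_tmp; apply: cvg_bilinear_bessel => //.
  exact: cos_sin_products_le1.
apply: rearrange_product => //.
- exact: cvgP (row a a).
- exact: cvgP (row b b).
Qed.

Unset Implicit Arguments.

(* The weight (1-s)^l1 (1+s)^l0 of the Jacobi polynomials, taken at
   s = cos(4 phi) = 2 cos^2(2 phi) - 1, forces the variable u of the cosine
   term to carry mu^l0 and the variable v of the sine term to carry mu^l1:
   with the two measures exchanged the identity fails unless k0 = k1. *)
Theorem corollary1p2 (R : realType) (k0 k1 : R) (p : nat -> {poly R})
    (rho phi r theta : R) :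
  let gamma := 2 * (k0 + k1) in
  let l0 := k0 - 2^-1 in
  let l1 := k1 - 2^-1 in
  0 < k0 -> 0 < k1 ->
  (exists n : nat, (0 < n)%N /\ gamma = (2 * n)%:R) ->
  orthonormal_jacobi l1 l0 p ->
  0 <= rho -> 0 <= r ->
  0 <= phi <= pi / 4 -> 0 <= theta <= pi / 4 ->
  (gbessel_B2 k0 k1 p rho phi r theta)%:E =
    ((Gamma ((gamma + 1) / 2))%:E *
     \int[sym_beta l0]_(u in `[(-1)%R, 1%R])
       \int[sym_beta l1]_(v in `[(-1)%R, 1%R])
         (bessel_i ((gamma - 1) / 2)
            (rho * r * c_angle (2 * phi) (2 * theta) u v))%:E)%E
  /\ 0 < gbessel_B2 k0 k1 p rho phi r theta.
Proof.
move=> gamma l0 l1 k00 k10 [n [n0 gammaE]] op rho0 r0 _ _.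
set N := k0 + k1; set nu := (gamma - 1) / 2; set z := rho * r.
set a := 2 * phi; set b := 2 * theta.
set c := cos b * cos a; set s := sin b * sin a.
have N1 : 1 <= N.
  have -> : N = n%:R.
    by move: gammaE; rewrite /gamma natrM => /mulfI; apply; rewrite pnatr_eq0.
  by rewrite ler1n.
have N0 : 0 < N by lra.
have nuE : nu = N - 2^-1 by rewrite /nu /gamma -/N; field.
have nu0 : 0 <= nu by rewrite nuE; lra.
have cs : `|c| + `|s| <= 1 by exact: cos_sin_products_le1.
have -> : (gamma + 1) / 2 = N + 2^-1 by rewrite /gamma -/N; field.
have GN0 : 0 < Gamma (N + 2^-1) by rewrite Gamma_gt0//; lra.
set S := limn (series (fun m => bessel_term nu (z / 2) m * bilinear_moment k0 k1 c s m)).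
have intE : (\int[sym_beta l0]_(u in `[(-1)%R, 1%R])
       \int[sym_beta l1]_(v in `[(-1)%R, 1%R])
         (bessel_i nu (z * c_angle a b u v))%:E = S%:E)%E.
  apply: etrans (integral_bilinear_bessel z nu0 k00 k10 cs).
  apply: eq_integral => u _; apply: eq_integral => v _.
  by rewrite /c_angle /c /s !mulrA.
have Spos : 0 < S.
  apply: lt_le_trans (bilinear_bessel_ge z nu0 k00 k10 cs).
  by rewrite invr_gt0 Gamma_gt0// ltr_wpDl.
suff -> : gbessel_B2 k0 k1 p rho phi r theta = Gamma (N + 2^-1) * S.
  by split; [rewrite intE EFinM|exact: mulr_gt0].
rewrite /gbessel_B2 -/gamma -/z; case: eqP => [z0|/eqP z_neq0].
  (* For rho r = 0 only the term m = 0 of the series is left. *)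
  have -> : S = (Gamma (N + 2^-1))^-1; last by rewrite mulfV ?gt_eqF.
  rewrite /S z0 mul0r; apply/cvg_lim => //.
  rewrite (_ : N + 2^-1 = nu + 1); last by rewrite nuE; field.
  exact: bilinear_bessel0.
have z0 : 0 < z by rewrite lt_neqAle eq_sym z_neq0 mulr_ge0.
set h := z / 2; have h0 : 0 < h by rewrite divr_gt0.
have C0 := c2_gt0 k00 k10.
have N2 : 2^-1 <= N by lra.
have := jacobi_bessel_series (z := z) (a := a) (b := b) k00 k10 N2 op.
cbv zeta; rewrite -/N -nuE -/c -/s -/S => side.
have sideh : series (fun j => bessel_I ((4 * j)%:R + gamma) z *
    (p j).[cos (4 * phi)] * (p j).[cos (4 * theta)]) @ \oo -->
    h `^ gamma * (Gamma (N + 2^-1) / c2 k0 k1 * S).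
  rewrite (_ : (fun j => _) = h `^ gamma *: (fun j => bessel_column N z j *
     ((p j).[cos (2 * a)] * (p j).[cos (2 * b)]))).
    by rewrite seriesZ; apply: cvgZl_tmp.
  apply/funext => j.
  rewrite -[RHS]/(h `^ gamma * (bessel_column N z j *
     ((p j).[cos (2 * a)] * (p j).[cos (2 * b)]))).
  rewrite bessel_IE//; last by rewrite addr_ge0// /gamma mulr_ge0// ltW.
  rewrite powRD ?(gt_eqF h0) ?implybT// powR_mulrn ?(ltW h0)//.
  have -> : 2 * a = 4 * phi by rewrite /a mulrA -natrM.
  have -> : 2 * b = 4 * theta by rewrite /b mulrA -natrM.
  by rewrite /bessel_column -/h -/gamma; ring.
rewrite (cvg_lim _ sideh)//.
have hg : (2 / (r * rho)) `^ gamma * h `^ gamma = 1.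
  have rz : 0 < r * rho by rewrite mulrC.
  rewrite -powRM ?(ltW h0)//; last by rewrite divr_ge0 ?(ltW rz).
  rewrite (_ : 2 / (r * rho) * h = 1) ?powR1//.
  rewrite /h /z (mulrC rho); move: (r * rho) rz => t t0.
  by field; rewrite gt_eqF.
move: hg C0; move: (_ `^ _) (_ `^ _) (c2 _ _) (Gamma _) => E1 E2 C G hg C0.
transitivity (E2 * E1 * (C * (G / C * S))); first by ring.
by rewrite hg; field; rewrite gt_eqF.
Qed.
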